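(* Let $Z$ be any measurable space and let $\rho(x,z)=\rho(x|z)\nu(z)\in P(\mathbb{R}^d\times Z)$ be any probability measure, with $\mathbb{R}^d$-marginal $\rho(x)$. Then there exists a Wasserstein barycenter $\mu\in P(\mathbb{R}^d)$ of $\rho(x,z)$ that satisfies $$Var(\rho(x)) - Var(\mu) = \int_Z W_2^2(\rho(\cdot|z),\mu)\, d\nu(z),$$ where, when infinite values occur, the identity is read as $Var(\rho(x)) = Var(\mu) + \int_Z W_2^2(\rho(\cdot|z),\mu)\, d\nu(z)$ in $[0,\infty]$.
   Context: $P(\cdot)$ denotes probability measures (Borel in the $\mathbb{R}^d$ variable). $\nu$ is the $Z$-marginal of $\rho(x,z)$ and $\rho(\cdot|z)\in P(\mathbb{R}^d)$ are the conditional distributions obtained by disintegration, so $\rho(x)=\int_Z\rho(\cdot|z)\,d\nu(z)$. $W_2$ is the 2-Wasserstein distance: $W_2^2(\alpha,\beta)=\inf_\pi\int\|x-y\|^2d\pi(x,y)\in[0,\infty]$ over couplings $\pi$ of $\alpha,\beta\in P(\mathbb{R}^d)$. A Wasserstein barycenter of $\rho(x,z)$ is a $\mu\in P(\mathbb{R}^d)$ attaining $\inf_{\mu'\in P(\mathbb{R}^d)}\int_Z W_2^2(\rho(\cdot|z),\mu')\,d\nu(z)$. For $\eta\in P(\mathbb{R}^d)$ with finite second moment and mean $\overline{x}$, $Var(\eta)=\int\|x-\overline{x}\|^2d\eta(x)$; $Var(\eta)=\infty$ if the second moment is infinite. *)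

(* Defs.v *)
From HB Require Import structures.
From mathcomp Require Import all_boot all_order all_algebra.
From mathcomp Require Import all_classical all_reals all_analysis.

Set Implicit Arguments.
Unset Strict Implicit.
Unset Printing Implicit Defensive.

Import Order.TTheory GRing.Theory Num.Theory.
Import numFieldNormedType.Exports.

Local Open Scope classical_set_scope.
Local Open Scope ring_scope.

HB.instance Definition _ d1 d2 (T1 : measurableType d1)
    (T2 : measurableType d2) :=
  isMeasurableFun.Build _ _ (T1 * T2)%type T1 fst measurable_fst.

HB.instance Definition _ d1 d2 (T1 : measurableType d1)
    (T2 : measurableType d2) :=
  isMeasurableFun.Build _ _ (T1 * T2)%type T2 snd measurable_snd.

(* R^d as row vectors, with the Borel sigma-algebra. *)
Definition Rd (R : realType) (d : nat) : Type :=
  g_sigma_algebraType (@open 'rV[R]_d).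

HB.instance Definition _ (R : realType) (d : nat) := Measurable.on (Rd R d).

(* The library norm on row vectors is the sup norm; this is the square of the
   Euclidean one. *)
Definition sqnorm (R : realType) (d : nat) (v : 'rV[R]_d) : R :=
  \sum_(i < d) v ord0 i ^+ 2.

Section variance.
Local Open Scope ereal_scope.
Variables (R : realType) (d : nat).
Implicit Types eta : {measure set (Rd R d) -> \bar R}.

Definition second_moment eta : \bar R :=
  \int[eta]_x (sqnorm (x : 'rV[R]_d))%:E.

(* Only meaningful when the coordinates are integrable, in particular when the
   second moment is finite. *)
Definition mean eta : 'rV[R]_d :=
  (\row_(i < d) \int[eta]_x ((x : 'rV[R]_d) ord0 i))%R.

Definition Var eta : \bar R :=
  if second_moment eta < +oo then
    \int[eta]_x (sqnorm ((x : 'rV[R]_d) - mean eta)%R)%:E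
  else +oo.

End variance.

Section wasserstein.
Local Open Scope ereal_scope.
Variables (R : realType) (d : nat).
Implicit Types alpha beta : {measure set (Rd R d) -> \bar R}.

Definition coupling alpha beta
    (p : probability (Rd R d * Rd R d)%type R) : Prop :=
  (forall A, measurable A -> distribution p fst A = alpha A) /\
  (forall B, measurable B -> distribution p snd B = beta B).

(* The square of the 2-Wasserstein distance, with values in [0, +oo]. *)
Definition W2sq alpha beta : \bar R :=
  ereal_inf [set \int[p]_xy (sqnorm ((xy.1 : 'rV[R]_d) - xy.2)%R)%:E
            | p in coupling alpha beta].

End wasserstein.

Section barycenter.
Local Open Scope ereal_scope.
Context (R : realType) (d : nat) (dZ : measure_display) (Z : measurableType dZ).
Variable rho : probability (Rd R d * Z)%type R.

Definition marginalX : probability (Rd R d) R := distribution rho fst.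

Definition marginalZ : probability Z R := distribution rho snd.

(* rho(x, z) = rho(x | z) nu(z), where nu is the Z-marginal of rho and
   k z = rho( . | z). *)
Definition disintegration (k : R.-pker Z ~> Rd R d) : Prop :=
  forall A B, measurable A -> measurable B ->
    rho (A `*` B) = \int[marginalZ]_(z in B) k z A.

Variable k : R.-pker Z ~> Rd R d.

Definition barycenter_cost (mu : probability (Rd R d) R) : \bar R :=
  \int[marginalZ]_z W2sq (k z) mu.

Definition wasserstein_barycenter (mu : probability (Rd R d) R) : Prop :=
  barycenter_cost mu = ereal_inf (range barycenter_cost).

End barycenter.

(* Main.v *)
(* Dilating mu about a point p by a factor s changes the cost of every coupling of
   rho(.|z) and mu by an explicit combination of that cost and of the second moments
   about p. A barycenter mu is optimal at s = 1, and the first-order condition reads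
   \int |x - p|^2 drho = \int |y - p|^2 dmu + \int W_2^2(rho(.|z), mu) dnu for all p.
   Minimizing both sides over p gives the identity between the variances, with no
   measurable selection of optimal couplings. If the second moment of rho or of mu is
   infinite while the cost is finite, then both are.

   A minimizing sequence is tight, so it has a weak limit mu. To pass to the limit
   inside the integral over Z, W_2^2(alpha, mu) is written as the increasing limit of
   relaxed problems over all plans, where the marginal constraints are replaced by
   penalties on finitely many test integrals. The relaxed values are measurable in z
   and depend continuously on the test integrals of mu. *)

Require Import Defs.
From HB Require Import structures.
From mathcomp Require Import all_boot all_order all_algebra.
From mathcomp Require Import all_classical all_reals all_analysis.
From mathcomp Require Import measurable_realfun giry ring lra.

Set Implicit Arguments.
Unset Strict Implicit.
Unset Printing Implicit Defensive.
Import Order.TTheory GRing.Theory Num.Theory.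
Import numFieldNormedType.Exports.
Local Open Scope classical_set_scope.
Local Open Scope ring_scope.

(** * Borel functions on R^d *)

(** Nothing is assumed on [Z], so a kernel value [k z] is reached only through countably many test
    integrals, each measurable in [z]. This is what makes [W2sq (k z) mu] measurable in [z], and
    with it every splitting of integrals over [Z]. Weak limits are taken along an ultrafilter on the
    indices: the integrals of all bounded continuous functions then converge at once, and a Daniell
    construction, fed by tightness, turns the limit functional into a measure. Plans are measures on
    rows of length [d + d], so the same compactness theorem serves for plans and for barycenters.
    Moments and costs may be infinite. The inequalities behind the moment identity are therefore
    kept with nonnegative terms on both sides, and real arithmetic starts only once everything is
    known to be finite. *)

Definition rat_box (R : realType) (n : nat)
    (p : 'rV[rat]_n * 'rV[rat]_n) : set 'rV[R]_n :=
  [set x | forall i, ratr (p.1 ord0 i) < x ord0 i < ratr (p.2 ord0 i)].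

(** The index type is countable, so rational boxes generate the Borel sets. Boxes that leave [U] are
    replaced by [set0] to keep the union over the whole type. *)
Lemma open_bigcup_rat_box (R : realType) (n : nat) (U : set 'rV[R]_n) :
  open U ->
  U = \bigcup_p (if `[< rat_box p `<=` U >] then rat_box p else set0).
Proof.
move=> oU; apply/seteqP; split => [x Ux|x [p _]]; last first.
  by case: ifPn => // /asboolP; apply.
move: oU; rewrite openE => /(_ x Ux); rewrite /interior => /nbhs_ballP[e /= e0 eU].
have qa i : {q : rat | x ord0 i - e < ratr q < x ord0 i}.
  apply: cid; have /rat_in_itvoo[q] : x ord0 i - e < x ord0 i by rewrite ltrBlDr ltrDl.
  by rewrite inE/= => qx; exists q; move/itvP: qx => qx; rewrite !qx.
have qb i : {q : rat | x ord0 i < ratr q < x ord0 i + e}.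
  apply: cid; have /rat_in_itvoo[q] : x ord0 i < x ord0 i + e by rewrite ltrDl.
  by rewrite inE/= => qx; exists q; move/itvP: qx => qx; rewrite !qx.
exists (\row_i sval (qa i), \row_i sval (qb i)) => //.
case: ifPn => [_ i|/asboolP]; last case.
  rewrite !mxE.
  by case: (qa i) => a /= /andP[_ ->]; case: (qb i) => b /= /andP[->].
move=> y yx; apply: eU; split=> // i j; rewrite ord1 {i}.
have := yx j; rewrite !mxE.
case: (qa j) => a /= /andP[xa ax]; case: (qb j) => b /= /andP[xb bx] /andP[ay yb].
by rewrite /ball/= ltr_distlC; apply/andP; split; lra.
Qed.

Lemma measurable_fun_Rd (R : realType) (n : nat) d (T : measurableType d)
    (Y : T -> Rd R n) :
  (forall i, measurable_fun setT (fun t => (Y t : 'rV[R]_n) ord0 i)) ->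
  measurable_fun setT Y.
Proof.
move=> mY; apply: (@measurability _ _ T (Rd R n) setT Y (@open (matrix R 1 n))) => //.
move=> _ [U oU <-]; rewrite setTI (open_bigcup_rat_box oU) preimage_bigcup.
apply: countable_bigcupT_measurable => // p.
case: ifPn => _; last by rewrite preimage_set0.
suff -> : Y @^-1` rat_box p = \bigcap_(i in [set: 'I_n])
    ((fun t => (Y t : 'rV[R]_n) ord0 i) @^-1`
      `]ratr (p.1 ord0 i), ratr (p.2 ord0 i)[%classic).
  apply: fin_bigcap_measurable => // i _.
  by rewrite -[X in measurable X]setTI; apply: mY.
apply/seteqP; split => t /= Yt i; first by move=> _; exact: Yt.
exact: Yt i Logic.I.
Qed.

Lemma continuous_measurable_Rd (R : realType) (n : nat) (f : 'rV[R]_n -> R) :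
  continuous f -> measurable_fun setT (f : Rd R n -> R).
Proof.
move=> /continuousP cf; apply: (measurability _ (RGenOpens.measurableE R)).
move=> _ [_ [a [b ->] <-]]; rewrite setTI; apply: sub_sigma_algebra.
by apply: cf; exact: interval_open.
Qed.

Lemma continuous_measurable_RdV (R : realType) (m n : nat) (f : 'rV[R]_m -> 'rV[R]_n) :
  continuous f -> measurable_fun setT (f : Rd R m -> Rd R n).
Proof.
move=> cf; apply: measurable_fun_Rd => i; apply: continuous_measurable_Rd => x.
apply: (@continuous_comp _ _ _ f (fun y : 'rV[R]_n => y ord0 i)); first exact: cf.
exact: coord_continuous.
Qed.

(* The projection of t onto [0, 1], as a formula whose continuity is immediate. *)
Definition clip (R : realType) (t : R) : R := (1 + `|t| - `|t - 1|) / 2.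

Section clip.
Variable R : realType.
Implicit Types s t : R.

Lemma clip_continuous : continuous (@clip R).
Proof.
move=> t; apply: cvgM; last exact: cvg_cst.
apply: cvgB; last first.
  by apply: cvg_norm; apply: cvgB; [|exact: cvg_cst].
by apply: cvgD; [exact: cvg_cst|exact: cvg_norm].
Qed.

Lemma clip_ge0 t : 0 <= clip t.
Proof. by rewrite /clip; case: (ger0P t); case: (ger0P (t - 1)); lra. Qed.

Lemma clip_le1 t : clip t <= 1.
Proof. by rewrite /clip; case: (ger0P t); case: (ger0P (t - 1)); lra. Qed.

Lemma le_clip s t : s <= t -> clip s <= clip t.
Proof.
rewrite /clip; case: (ger0P t); case: (ger0P (t - 1));
  case: (ger0P s); case: (ger0P (s - 1)); lra.
Qed.

Lemma clip1 t : 1 <= t -> clip t = 1.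
Proof. by rewrite /clip; case: (ger0P t); case: (ger0P (t - 1)); lra. Qed.

Lemma clip0 t : t <= 0 -> clip t = 0.
Proof. by rewrite /clip; case: (ger0P t); case: (ger0P (t - 1)); lra. Qed.

Lemma clip_id t : 0 <= t <= 1 -> clip t = t.
Proof. by rewrite /clip; case: (ger0P t); case: (ger0P (t - 1)); lra. Qed.

End clip.

Definition Cb (R : realType) (n : nat) (f : 'rV[R]_n -> R) : Prop :=
  continuous f /\ exists M, forall x, `|f x| <= M.

Section Cb.
Context (R : realType) (n : nat).
Implicit Types f g : 'rV[R]_n -> R.

Lemma Cb_cst (c : R) : Cb (fun _ : 'rV[R]_n => c).
Proof. by split => [|]; [exact: cst_continuous|exists `|c|]. Qed.

Lemma CbD f g : Cb f -> Cb g -> Cb (fun x => f x + g x).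
Proof.
move=> [cf [M fM]] [cg [N gN]]; split.
  by move=> x; exact: (continuousD (cf x) (cg x)).
by exists (M + N) => x; rewrite (le_trans (ler_normD _ _))// lerD.
Qed.

Lemma CbM f g : Cb f -> Cb g -> Cb (fun x => f x * g x).
Proof.
move=> [cf [M fM]] [cg [N gN]]; split.
  by move=> x; exact: (continuousM (cf x) (cg x)).
by exists (M * N) => x; rewrite normrM ler_pM.
Qed.

Lemma CbB f g : Cb f -> Cb g -> Cb (fun x => f x - g x).
Proof.
move=> [cf [M fM]] [cg [N gN]]; split.
  by move=> x; exact: (continuousB (cf x) (cg x)).
by exists (M + N) => x; rewrite (le_trans (ler_normB _ _))// lerD.
Qed.

Lemma Cb_sum (I : Type) (r : seq I) (F : I -> 'rV[R]_n -> R) :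
  (forall i, Cb (F i)) -> Cb (fun x => \sum_(i <- r) F i x).
Proof.
move=> cF; elim: r => [|i r IH].
  by under eq_fun do rewrite big_nil; exact: Cb_cst.
by under eq_fun do rewrite big_cons; exact: CbD.
Qed.

Lemma Cb_clip f : continuous f -> Cb (fun x => clip (f x)).
Proof.
move=> cf; split.
  by move=> x; apply: (@continuous_comp _ _ _ f (@clip R)); [exact: cf|exact: clip_continuous].
by exists 1 => x; rewrite ger0_norm ?clip_ge0 ?clip_le1.
Qed.

End Cb.

(** The enumeration is chosen before [a]: the same one must reindex the values of a double family of
    functions at every point and the values of [L] on that family. *)
Lemma nneseries_unpair (R : realType) :
  exists e : nat -> nat * nat, forall a : nat -> nat -> \bar R, (forall i j, (0 <= a i j)%E) ->
    (\sum_(i <oo) \sum_(j <oo) a i j = \sum_(k <oo) a (e k).1 (e k).2)%E.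
Proof.
have /card_esym/ppcard_eqP[f] := card_nat2.
exists f => a a0.
rewrite [RHS]nneseries_esumT// nneseries_esumT; last first.
  by move=> i; exact: nneseries_ge0.
under eq_esum do rewrite nneseries_esumT//.
rewrite esum_esum//= (_ : setT `*`` (fun=> setT) = setT); last first.
  by apply/seteqP; split.
by rewrite (reindex_esum setT setT f (fun x => a x.1 x.2)).
Qed.

(** * Daniell's theorem and weak compactness *)

(** The term of index [i] is the length of the part of [[0, t]] in the slice [[i, i + 1]]. *)
Lemma sum_clip (R : realType) (N : nat) (t : R) :
  0 <= t <= N%:R -> \sum_(i < N) clip (t - i%:R) = t.
Proof.
elim: N t => [|N IH] t /andP[t0 tN]; first by rewrite big_ord0; lra.
rewrite big_ord_recr/=; have [tleN|Nltt] := lerP t N%:R.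
  by rewrite IH ?t0// clip0 ?addr0// subr_le0.
rewrite (eq_bigr (fun=> 1)) => [|i _].
  rewrite sumr_const card_ord clip_id; first by rewrite addrC subrK.
  by rewrite subr_ge0 ltW//= lerBlDl natr1.
rewrite clip1// lerBrDl; apply: le_trans (ltW Nltt).
by rewrite natr1 ler_nat ltn_ord.
Qed.

(** Slice [i + 1] is at most 1 and vanishes unless [i + 1 <= t]; the bottom slice accounts for the
    extra 1. *)
Lemma le_sum_indicators (R : realType) (N : nat) (t : R) :
  0 <= t <= N%:R -> t <= 1 + \sum_(i < N) (i.+1%:R <= t)%R%:R.
Proof.
case: N => [|N] t0N; first by rewrite big_ord0; move: t0N => /andP[]; lra.
rewrite -{1}(sum_clip t0N) big_ord_recl lerD ?clip_le1//.
rewrite big_ord_recr/= ler_wpDr// ler_sum// => i _.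
have [it|ti] := lerP i.+1%:R t; first exact: clip_le1.
by rewrite clip0// subr_le0 ltW.
Qed.

Lemma Cb_integrable (R : realType) (n : nat)
    (Q : {finite_measure set (Rd R n) -> \bar R}) (f : 'rV[R]_n -> R) :
  Cb f -> Q.-integrable setT (EFin \o (f : Rd R n -> R)).
Proof.
move=> [cf [M fM]]; apply: measurable_bounded_integrable => //.
- by rewrite ltey_eq fin_num_measure.
- exact: continuous_measurable_Rd.
- exists M; split; first exact: num_real.
  by move=> x Mx y _; exact: le_trans (fM y) (ltW Mx).
Qed.

Lemma EFin_Rintegral d (T : measurableType d) (R : realType)
    (mu : {measure set T -> \bar R}) (f : T -> R) :
  mu.-integrable setT (EFin \o f) ->
  (\int[mu]_x f x)%:E = (\int[mu]_x (f x)%:E)%E.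
Proof. by move=> fi; rewrite fineK// integrable_fin_num. Qed.

Section daniell.
Local Open Scope ereal_scope.
Context (R : realType) (n : nat) (L : ('rV[R]_n -> R) -> R).
Hypothesis LD : forall f g, Cb f -> Cb g ->
  (L (fun x => f x + g x) = L f + L g)%R.
Hypothesis LZ : forall (c : R) f, Cb f -> (L (fun x => c * f x) = c * L f)%R.
Hypothesis L1 : L (fun=> 1%R) = 1%R.
Hypothesis L_ge0 : forall f, Cb f -> (forall x, 0 <= f x)%R -> (0 <= L f)%R.
Hypothesis L_series : forall (f : nat -> 'rV[R]_n -> R) g,
  (forall k, Cb (f k)) -> (forall k x, 0 <= f k x)%R -> Cb g ->
  (forall x, (g x)%:E <= \sum_(k <oo) (f k x)%:E) ->
  (L g)%:E <= \sum_(k <oo) (L (f k))%:E.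

Let L0 : L (fun=> 0%R) = 0%R.
Proof.
by have := LZ 0%R (Cb_cst n (1%R : R)); rewrite !mul0r.
Qed.

Let LB f g : Cb f -> Cb g -> (L (fun x => f x - g x) = L f - L g)%R.
Proof.
move=> cf cg; have := LD cf (CbM (Cb_cst n (-1)%R) cg).
rewrite (LZ _ cg) mulN1r => <-.
by congr L; apply/funext => x; rewrite mulN1r.
Qed.

Let Lsum (I : Type) (r : seq I) (F : I -> 'rV[R]_n -> R) :
  (forall i, Cb (F i)) ->
  (L (fun x => \sum_(i <- r) F i x) = \sum_(i <- r) L (F i))%R.
Proof.
move=> cF; elim: r => [|i r IH].
  by rewrite big_nil -[RHS]L0; congr L; apply/funext => x; rewrite big_nil.
rewrite big_cons -IH -LD//; last exact: Cb_sum.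
by congr L; apply/funext => x; rewrite big_cons.
Qed.

(* Covering by series of functions makes countable subadditivity immediate. *)
Definition daniell_cover (A : set 'rV[R]_n) (f : nat -> 'rV[R]_n -> R) :=
  [/\ forall k, Cb (f k), forall k x, (0 <= f k x)%R &
      forall x, A x -> 1 <= \sum_(k <oo) (f k x)%:E].

Definition daniell_outer (A : set 'rV[R]_n) : \bar R :=
  ereal_inf [set \sum_(k <oo) (L (f k))%:E | f in daniell_cover A].

Let le_outer_cover2 A (f : nat -> nat -> 'rV[R]_n -> R) :
  (forall i j, Cb (f i j)) -> (forall i j x, 0 <= f i j x)%R ->
  (forall x, A x -> 1 <= \sum_(i <oo) \sum_(j <oo) (f i j x)%:E) ->
  daniell_outer A <= \sum_(i <oo) \sum_(j <oo) (L (f i j))%:E.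
Proof.
move=> cf f0 fA; have [e eE] := nneseries_unpair R.
rewrite eE => [|i j]; last by rewrite lee_fin L_ge0.
apply: ereal_inf_lbound; exists (fun k => f (e k).1 (e k).2) => //.
split=> // x Ax; rewrite (le_trans (fA _ Ax))// (eE (fun i j => (f i j x)%:E))//.
by move=> i j; rewrite lee_fin.
Qed.

Let le_outer_cover1 A (f : 'rV[R]_n -> R) :
  Cb f -> (forall x, 0 <= f x)%R -> (forall x, A x -> 1 <= f x)%R ->
  daniell_outer A <= (L f)%:E.
Proof.
move=> cf f0 fA; pose F (k : nat) : 'rV[R]_n -> R := if k is 0%N then f else fun=> 0%R.
have F0 x k : (0 <= F k x)%R by case: k.
have FE (h : ('rV[R]_n -> R) -> R) : h (fun=> 0%R) = 0%R ->
    (forall k, 0 <= h (F k))%R -> \sum_(k <oo) (h (F k))%:E = (h f)%:E.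
  move=> h0 hF; rewrite nneseries_recl// => [|k]; last by rewrite lee_fin.
  rewrite eseries_cond/= eseries0 ?adde0// => -[|k] //= _ _.
  by rewrite h0.
apply: ereal_inf_lbound; exists F; last first.
  by apply: FE => // -[|k]; rewrite /= ?L0 ?L_ge0.
split => // [[|k] //|x Ax]; first exact: Cb_cst.
by rewrite (FE (fun h => h x))// lee_fin fA.
Qed.

Let outer0 : daniell_outer set0 = 0.
Proof.
apply/eqP; rewrite eq_le; apply/andP; split.
  by rewrite -[leRHS]/(0%R%:E) -L0; apply: le_outer_cover1 => //; exact: Cb_cst.
apply: le_ereal_inf_tmp => _ [f [cf f0 _] <-].
by apply: nneseries_ge0 => k _ _; rewrite lee_fin L_ge0.
Qed.

Let outer_ge0 A : 0 <= daniell_outer A.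
Proof.
apply: le_ereal_inf_tmp => _ [f [cf f0 _] <-].
by apply: nneseries_ge0 => k _ _; rewrite lee_fin L_ge0.
Qed.

Let outer_subadditive A F : subset_sigma_subadditive daniell_outer A F.
Proof.
move=> AF; have [->|Foo] := eqVneq (\sum_(i <oo) daniell_outer (F i)) +oo.
  by rewrite leey.
have Ffin i : daniell_outer (F i) \is a fin_num.
  rewrite ge0_fin_numE// ltey; apply/eqP => Fi; move/eqP: Foo; apply.
  by apply: (eseries_pinfty _ _ Fi) => // j _; rewrite gt_eqF// (lt_le_trans ltNy0).
apply/lee_addgt0Pr => e e0; apply: le_trans (epsilon_trick xpredT _ (ltW e0)) => //.
have [G] : {G : nat -> nat -> 'rV[R]_n -> R & forall i, daniell_cover (F i) (G i) /\
    \sum_(k <oo) (L (G i k))%:E <= daniell_outer (F i) + (e / (2 ^ i.+1)%:R)%:E}.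
  apply: (@choice _ _ (fun i G => daniell_cover (F i) G /\
    \sum_(k <oo) (L (G k))%:E <= daniell_outer (F i) + (e / (2 ^ i.+1)%:R)%:E)) => i.
  have e2 : (0 < e / (2 ^ i.+1)%:R)%R by rewrite divr_gt0// ltr0n expn_gt0.
  have [_ [G cG <-] Ge] := lb_ereal_inf_adherent e2 (Ffin i).
  by exists G; split => //; exact: ltW.
move=> GP; have G0 i j x : (0 <= G i j x)%R by have [[]] := GP i.
have cG i j : Cb (G i j) by have [[]] := GP i.
apply: (@le_trans _ _ (\sum_(i <oo) \sum_(j <oo) (L (G i j))%:E)).
  apply: le_outer_cover2 => // x /AF[i _ Fix].
  have [[_ _ fA] _] := GP i; apply: le_trans (fA x Fix) _.
  rewrite [leRHS](@nneseriesD1 _ _ i predT)//; last first.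
    by move=> j _; apply: nneseries_ge0 => k _ _; rewrite lee_fin.
  rewrite leeDl// nneseries_ge0// => j _ _.
  by apply: nneseries_ge0 => k _ _; rewrite lee_fin.
apply: lee_nneseries => [i _ _|i _]; last by have [] := GP i.
by apply: nneseries_ge0 => k _ _; rewrite lee_fin L_ge0.
Qed.

HB.instance Definition _ := isSubsetOuterMeasure.Build R 'rV[R]_n daniell_outer
  outer0 outer_ge0 outer_subadditive.

(** The functions [h k] increase to the indicator of [O]. Multiplying a cover [f] of [X] by all
    increments [h k.+1 - h k] covers the part of [X] in [O]; multiplying it by [1 - h K] covers the
    part outside [O], for every [K]. The first [K] increments and [1 - h K] add up to 1, so the
    values of [L] add up to those for [f]. *)
Let carath (g : 'rV[R]_n -> R) : continuous g ->
  daniell_outer.-caratheodory [set x | 0 < g x]%R.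
Proof.
move=> cg; apply: le_caratheodory_measurable => X; set O := [set x | _].
pose h (k : nat) (x : 'rV[R]_n) : R := clip (k%:R * g x).
have ch k : Cb (h k).
  by apply: Cb_clip => x; apply: (continuousM _ (cg x)); exact: cst_continuous.
have h0 x : h 0%N x = 0%R by rewrite /h mul0r clip0.
have hO k x : ~ O x -> h k x = 0%R.
  by move=> /negP; rewrite -leNgt => gx; rewrite /h clip0// mulr_ge0_le0.
have hS k x : (h k x <= h k.+1 x)%R.
  have [gx|gx] := ltrP 0 (g x); last by rewrite !hO//; apply/negP; rewrite -leNgt.
  by rewrite le_clip// ler_pM2r// ler_nat.
have h1 x : O x -> exists k, h k x = 1%R.
  move=> gx; exists (Num.truncn (g x)^-1).+1; rewrite /h clip1//.
  by rewrite -ler_pdivrMr// div1r ltW// truncnS_gt.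
apply: le_ereal_inf_tmp => _ [f [cf f0 fX] <-].
set S := (leRHS); have [->|Soo] := eqVneq S +oo; first by rewrite leey.
pose a k i := L (fun x => f i x * (h k.+1 x - h k x))%R.
have cfh i k : Cb (fun x => f i x * (h k.+1 x - h k x))%R.
  by apply: CbM => //; exact: CbB.
have a_ge0 k i : (0 <= a k i)%R.
  by apply: L_ge0 => // x; rewrite mulr_ge0// subr_ge0.
have suma K i : (\sum_(0 <= k < K) a k i = L (fun x => f i x * h K x))%R.
  rewrite (eq_bigr (fun k => L (fun x => f i x * h k.+1 x) -
                             L (fun x => f i x * h k x))%R) => [|k _].
    rewrite telescope_sumr// [X in (_ - X)%R](_ : _ = 0)%R ?subr0//.
    by rewrite -L0; congr L; apply/funext => x; rewrite h0 mulr0.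
  rewrite -LB; try exact: CbM.
  by congr L; apply/funext => x; rewrite mulrBr.
have XO : daniell_outer (X `&` O) <= \sum_(k <oo) \sum_(i <oo) (a k i)%:E.
  apply: le_outer_cover2 => // [k i x|x [Xx Ox]].
    by rewrite mulr_ge0// subr_ge0.
  have [K hK] := h1 x Ox; apply: le_trans (fX x Xx) _.
  have t0 k : 0 <= \sum_(j <oo) (f j x * (h k.+1 x - h k x))%:E.
    by apply: nneseries_ge0 => j _ _; rewrite lee_fin mulr_ge0// subr_ge0.
  apply: le_trans (nneseries_lim_ge K _); last by move=> *; exact: t0.
  rewrite -nneseries_sum_nat; last by move=> k j; rewrite lee_fin mulr_ge0// subr_ge0.
  apply: lee_nneseries => [j _ _|j _]; first by rewrite lee_fin.
  rewrite sumEFin lee_fin -mulr_sumr telescope_sumr// h0 subr0 hK mulr1//.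
have XnO K : daniell_outer (X `&` ~` O) <=
    \sum_(i <oo) (L (fun x => f i x * (1 - h K x)))%:E.
  apply: ereal_inf_lbound; exists (fun i x => f i x * (1 - h K x))%R => //.
  split=> [i|i x|x [Xx Ox]].
  - by apply: CbM => //; apply: CbB => //; exact: Cb_cst.
  - by rewrite mulr_ge0// subr_ge0 clip_le1.
  - apply: le_trans (fX x Xx) _; apply: lee_nneseries => [i _ _|i _].
      by rewrite lee_fin.
    by rewrite hO// subr0 mulr1.
have Sfin : S \is a fin_num.
  rewrite ge0_fin_numE ?ltey//; apply: nneseries_ge0 => i _ _.
  by rewrite lee_fin L_ge0.
have XnOfin : daniell_outer (X `&` ~` O) \is a fin_num.
  rewrite ge0_fin_numE//; apply: le_lt_trans (XnO 0%N) _.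
  rewrite (eq_eseriesr (g := fun i => (L (f i))%:E)) => [|i _].
    by rewrite -ge0_fin_numE// nneseries_ge0// => i _ _; rewrite lee_fin L_ge0.
  by congr (L _)%:E; apply/funext => x; rewrite h0 subr0 mulr1.
(* The outside part is finite and may be subtracted; it then suffices to bound each partial sum,
   pairing the first [K] increments with the outside cover of the same [K]. *)
rewrite -leeBrDr//; apply: le_trans XO _.
apply: lime_le.
  apply: is_cvg_nneseries => k _ _; apply: nneseries_ge0 => i _ _.
  by rewrite lee_fin.
apply: nearW => K; rewrite leeBrDr//; apply: le_trans (leeD2l _ (XnO K)) _.
rewrite -nneseries_sum_nat; last by move=> k i; rewrite lee_fin.
rewrite -nneseriesD => [|i _ _|i _ _].
- apply: lee_nneseries => i *.
    rewrite adde_ge0 ?sume_ge0// => *; rewrite lee_fin// L_ge0//.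
      by apply: CbM => //; apply: CbB => //; exact: Cb_cst.
    by move=> x; rewrite mulr_ge0// subr_ge0 clip_le1.
  rewrite sumEFin -EFinD lee_fin suma -LD; last 2 first.
    exact: CbM.
    by apply: CbM => //; apply: CbB => //; exact: Cb_cst.
  rewrite le_eqVlt; apply/orP; left; apply/eqP; congr L; apply/funext => x.
  by rewrite -mulrDr addrC subrK mulr1.
- by rewrite sume_ge0// => *; rewrite lee_fin.
- rewrite lee_fin L_ge0//; last by move=> x; rewrite mulr_ge0// subr_ge0 clip_le1.
  by apply: CbM => //; apply: CbB => //; exact: Cb_cst.
Qed.

(** Open half-spaces have the form treated by [carath] and generate the Borel sets, which are thus
    Caratheodory measurable. *)
Let mid : measurable_fun setT
  (id : caratheodory_type daniell_outer -> Rd R n).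
Proof.
apply: measurable_fun_Rd => i.
apply: (measurability _ (RGenInftyO.measurableE R)).
move=> _ [_ [c ->] <-]; rewrite setTI.
rewrite [X in measurable X](_ : _ = [set x : 'rV[R]_n | 0 < c - x ord0 i]%R).
  by apply: carath => x; apply: (continuousB (@cst_continuous _ _ c x)); exact: coord_continuous.
by apply/seteqP; split => x; rewrite /= in_itv/= subr_gt0.
Qed.

Let outerT : daniell_outer setT = 1.
Proof.
apply/eqP; rewrite eq_le; apply/andP; split.
  by rewrite -[leRHS]/(1%R%:E) -L1; apply: le_outer_cover1 => //; exact: Cb_cst.
apply: le_ereal_inf_tmp => _ [f [cf f0 fT] <-].
(* Here [L_series] enters: a cover of the whole space dominates the constant 1. *)
rewrite -[leLHS]/(1%R%:E) -L1; apply: L_series => //; first exact: Cb_cst.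
by move=> x; exact: fT.
Qed.

Definition daniell_measure (A : set (Rd R n)) : \bar R := daniell_outer A.

Let dm0 : daniell_measure set0 = 0. Proof. exact: outer0. Qed.

Let dm_ge0 A : 0 <= daniell_measure A. Proof. exact: outer_ge0. Qed.

Let dm_sigma_additive : semi_sigma_additive daniell_measure.
Proof.
have mcara (A : set (Rd R n)) : measurable A ->
    measurable (A : set (caratheodory_type daniell_outer)).
  by move=> mA; rewrite -[A]setTI; exact: mid.
move=> F mF tF mUF; apply: caratheodory_measure_sigma_additive => //.
  by move=> i; exact: mcara.
exact: mcara.
Qed.

HB.instance Definition _ := isMeasure.Build _ _ _ daniell_measure
  dm0 dm_ge0 dm_sigma_additive.

HB.instance Definition _ :=
  Measure_isProbability.Build _ _ _ daniell_measure outerT.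

Let dmT : daniell_measure setT = 1. Proof. exact: outerT. Qed.

(** Cut [N * f] into unit slices. The slice [clip (N * f - i)] equals 1 on [A i], hence covers it,
    and [L] of it bounds the measure of [A i]. Summing gives [N] times the integral at most
    [1 + N * L f], and [N] is chosen so that the excess 1 is at most [N * e]. *)
Let dm_le (f : 'rV[R]_n -> R) : (forall x, 0 <= f x <= 1)%R -> Cb f ->
  (\int[daniell_measure]_x f x <= L f)%R.
Proof.
move=> f01 cf; apply/ler_addgt0Pr => e e0.
pose N := (Num.truncn e^-1).+1; have N0 : (0 < N%:R :> R)%R by rewrite ltr0n.
have Ne : (1 <= N%:R * e)%R.
  by rewrite -ler_pdivrMr// div1r ltW// truncnS_gt.
pose A (i : nat) : set (Rd R n) := [set x | i.+1%:R <= N%:R * f x]%R.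
have cNf : continuous (fun x => N%:R * f x)%R.
  by move=> x; apply: (continuousM _ (cf.1 x)); exact: cst_continuous.
have cA i : Cb (fun x => clip (N%:R * f x - i%:R))%R.
  apply: Cb_clip => x; apply: (continuousB (cNf x)); exact: cst_continuous.
have Nf01 x : (0 <= N%:R * f x <= N%:R)%R.
  have /andP[f0 f1] := f01 x.
  by rewrite mulr_ge0//= ler_piMr.
have mA i : measurable (A i).
  rewrite (_ : A i = (fun x : Rd R n => N%:R * f x)%R @^-1` `[i.+1%:R, +oo[%classic).
    by rewrite -[X in measurable X]setTI; exact: continuous_measurable_Rd.
  by apply/seteqP; split => x; rewrite /A/= in_itv/= andbT.
have QA i : (fine (daniell_measure (A i)) <= L (fun x => clip (N%:R * f x - i%:R)))%R.
  rewrite -lee_fin fineK ?fin_num_measure//; apply: le_outer_cover1 => //.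
    by move=> x; exact: clip_ge0.
  by move=> x Ax; rewrite clip1// lerBrDr addrC natr1.
have LN : (\sum_(i < N) L (fun x => clip (N%:R * f x - i%:R)) = N%:R * L f)%R.
  by rewrite -LZ// -Lsum//; congr L; apply/funext => x; rewrite sum_clip.
have fi := Cb_integrable daniell_measure cf.
have Nfi : daniell_measure.-integrable setT (EFin \o (fun x => N%:R * f x)%R).
  exact: (Cb_integrable daniell_measure (CbM (Cb_cst n N%:R) cf)).
rewrite -(ler_pM2l N0) mulrDr -LN -RintegralZl//.
apply: (@le_trans _ _ (1 + \sum_(i < N) fine (daniell_measure (A i)))%R); last first.
  by rewrite [leRHS]addrC lerD// ler_sum.
rewrite -lee_fin EFin_Rintegral// EFinD -sumEFin.
have mind i : measurable_fun setT (EFin \o (\1_(A i) : Rd R n -> R)).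
  by apply/measurable_EFinP.
apply: (@le_trans _ _ (\int[daniell_measure]_x (1 + \sum_(i < N) (\1_(A i) x)%:E))).
  apply: ge0_le_integral => //.
  - by move=> x _; rewrite lee_fin; have /andP[] := Nf01 x.
  - by case/integrableP : Nfi.
  - by apply: emeasurable_funD => //; apply: emeasurable_sum => i; exact: mind.
  - move=> x _; rewrite sumEFin -EFinD lee_fin.
    rewrite (le_trans (le_sum_indicators (Nf01 x)))// lerD2l ler_sum// => i _.
    by rewrite indicE; case: (boolP (i.+1%:R <= N%:R * f x)%R) => [h|_]; rewrite ?ler0n// mem_set.
rewrite ge0_integralD//; last 2 first.
  - by move=> x _; rewrite sume_ge0// => i _; rewrite lee_fin.
  - by apply: emeasurable_sum => i; exact: mind.
rewrite integral_cst//= dmT mule1 leeD2l//.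
rewrite ge0_integral_sum//; last by move=> i; exact: mind.
by apply: lee_sum => i _; rewrite integral_indic// setIT fineK// fin_num_measure.
Qed.

(** For [u] with values in [[0, 1]], [dm_le] applied to [1 - u] gives the reverse inequality; a
    bounded [f] is an affine image of such a [u]. *)
Lemma daniell_integral (f : 'rV[R]_n -> R) :
  Cb f -> (\int[daniell_measure]_x f x = L f)%R.
Proof.
have eq01 (u : 'rV[R]_n -> R) : (forall x, 0 <= u x <= 1)%R -> Cb u ->
    (\int[daniell_measure]_x u x = L u)%R.
  move=> u01 cu; apply/eqP; rewrite eq_le dm_le//=.
  have c1 := Cb_cst n (1%R : R).
  have := dm_le (f := fun x => (1 - u x)%R) _ (CbB c1 cu).
  rewrite LB// L1 RintegralB//; last 2 first.
  - exact: (Cb_integrable daniell_measure c1).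
  - exact: (Cb_integrable daniell_measure cu).
  rewrite Rintegral_cst//= dmT mul1r lerD2l lerN2; apply.
  by move=> x; have := u01 x; lra.
move=> cf; have [_ [M fM]] := cf.
pose K := (`|M| + 1)%R; have K0 : (0 < K)%R by rewrite /K ltr_pwDr.
have fK x : (`|f x| <= K)%R.
  by rewrite (le_trans (fM x))// (le_trans (ler_norm M))// lerDl.
pose u x := ((2 * K)^-1 * (f x + K))%R.
have cu : Cb u by apply: CbM; [exact: Cb_cst|apply: CbD => //; exact: Cb_cst].
have u01 x : (0 <= u x <= 1)%R.
  rewrite /u mulrC; move: (fK x); rewrite ler_norml => /andP[? ?].
  rewrite ler_pdivrMr ?mulr_gt0// divr_ge0//; lra.
have fE x : (f x = 2 * K * u x - K)%R.
  by rewrite /u mulrA mulfV ?mul1r ?addrK// gt_eqF// mulr_gt0.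
have := eq01 u u01 cu => uE.
have -> : f = (fun x => 2 * K * u x - K)%R by apply/funext.
have ui := Cb_integrable daniell_measure cu.
have c2u : Cb (fun x => 2 * K * u x)%R by apply: CbM => //; exact: Cb_cst.
rewrite LB//; last exact: Cb_cst.
rewrite RintegralB//; last 2 first.
- exact: (Cb_integrable daniell_measure c2u).
- exact: (Cb_integrable daniell_measure (Cb_cst n K)).
rewrite LZ// RintegralZl// uE Rintegral_cst//= dmT mulr1.
by have := LZ K (Cb_cst n 1%R); rewrite L1 !mulr1 => ->.
Qed.

Theorem daniell_riesz : exists Q : probability (Rd R n) R,
  forall f, Cb f -> (\int[Q]_x f x = L f)%R.
Proof. by exists daniell_measure; exact: daniell_integral. Qed.

End daniell.

Section riesz_tight.
Context (R : realType) (n : nat) (L : ('rV[R]_n -> R) -> R).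
Hypothesis LD : forall f g, Cb f -> Cb g -> L (fun x => f x + g x) = L f + L g.
Hypothesis LZ : forall (c : R) f, Cb f -> L (fun x => c * f x) = c * L f.
Hypothesis L1 : L (fun=> 1) = 1.
Hypothesis L_ge0 : forall f, Cb f -> (forall x, 0 <= f x) -> 0 <= L f.
Hypothesis L_tight : forall e, 0 < e ->
  exists M : R, L (fun x => clip (`|x| - M)) <= e.

Let Lle f g : Cb f -> Cb g -> (forall x, f x <= g x) -> L f <= L g.
Proof.
move=> cf cg fg; rewrite -subr_ge0 -mulN1r -LZ// -LD//; last first.
  by apply: CbM => //; exact: Cb_cst.
apply: L_ge0 => [|x]; last by rewrite mulN1r subr_ge0.
by apply: CbD => //; apply: CbM => //; exact: Cb_cst.
Qed.

Let Lcst c : L (fun=> c) = c.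
Proof. by have := LZ c (Cb_cst n 1); rewrite L1 !mulr1. Qed.

Let Lsum (I : Type) (r : seq I) (F : I -> 'rV[R]_n -> R) :
  (forall i, Cb (F i)) ->
  L (fun x => \sum_(i <- r) F i x) = \sum_(i <- r) L (F i).
Proof.
move=> cF; elim: r => [|i r IH].
  by rewrite big_nil -[RHS](Lcst 0); congr L; apply/funext => x; rewrite big_nil.
rewrite big_cons -IH -LD//; last exact: Cb_sum.
by congr L; apply/funext => x; rewrite big_cons.
Qed.

(* Dini's theorem on a ball carrying most of the mass. *)
Let L_series (f : nat -> 'rV[R]_n -> R) g :
  (forall k, Cb (f k)) -> (forall k x, 0 <= f k x) -> Cb g ->
  (forall x, (g x)%:E <= \sum_(k <oo) (f k x)%:E)%E ->
  ((L g)%:E <= \sum_(k <oo) (L (f k))%:E)%E.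
Proof.
move=> cf f0 cg gf; apply/lee_addgt0Pr => e e0.
have [_ [B gB]] := cg.
(* The error will be [d] from the ball and [|B| * d] from its complement, together [e]. *)
pose d := e / (1 + `|B|); have B0 : 0 < 1 + `|B| by rewrite ltr_pwDl.
have d0 : 0 < d by rewrite divr_gt0.
have [M LM] := L_tight d0.
pose K := [set x : 'rV[R]_n | `|x| <= M + 1].
have cK : compact K.
  apply: bounded_closed_compact.
    exists (M + 1); split; first exact: num_real.
    by move=> t Mt x Kx; exact: le_trans Kx (ltW Mt).
  rewrite (_ : K = (fun x : 'rV[R]_n => `|x|) @^-1` [set t | t <= M + 1])//.
  by apply: preimage_closed; [move=> x _; exact: norm_continuous|exact: closed_le].
have csum N : Cb (fun x => \sum_(0 <= k < N) f k x) by exact: Cb_sum.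
have [N HN] : exists N, forall x, K x -> g x - d < \sum_(0 <= k < N) f k x.
  (* Near each point some partial sum exceeds [g - d], and so do all later ones; compactness yields
     one [N] for the whole ball. *)
  have /compact_near_coveringP := cK.
  move=> /(_ nat \oo (fun N x => g x - d < \sum_(0 <= k < N) f k x) _)[].
    move=> x Kx.
    have [N0 hN0] : exists N0, g x - d < \sum_(0 <= k < N0) f k x.
      apply/not_existsP => h; have := gf x.
      apply/negP; rewrite -ltNge (@le_lt_trans _ _ (g x - d)%:E)//.
        apply: lime_le; first by apply: is_cvg_nneseries => *; rewrite lee_fin.
        by apply: nearW => N; rewrite sumEFin lee_fin leNgt; exact/negP.
      by rewrite lte_fin ltrBlDr ltrDl.
    have cgf : continuous (fun y => \sum_(0 <= k < N0) f k y - g y).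
      by have [] := CbB (csum N0) cg.
    have nx : \forall y \near x, - d < \sum_(0 <= k < N0) f k y - g y.
      apply: (@cvgr_gt _ _ (nbhs x) _ _ _ (cgf x)).
      by rewrite ltrBrDr addrC.
    exists ([set y | - d < \sum_(0 <= k < N0) f k y - g y], [set N | (N0 <= N)%N]).
      by split => //; exists N0.
    move=> [y N] [/= hy N0N]; rewrite (big_cat_nat _ N0N)//=.
    rewrite (@lt_le_trans _ _ (\sum_(0 <= k < N0) f k y))//; first by lra.
    by rewrite lerDl sumr_ge0.
  move=> N _ /(_ N (leqnn N)) hN; exists N => x Kx; exact: hN.
have cu : Cb (fun x : 'rV[R]_n => clip (`|x| - M)).
  apply: Cb_clip => x; apply: (continuousB _ (@cst_continuous _ _ M x)).
  exact: norm_continuous.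
have gle x : g x <= d + \sum_(0 <= k < N) f k x + `|B| * clip (`|x| - M).
  have [Kx|nKx] := pselect (K x).
    apply: ler_wpDr; first by rewrite mulr_ge0// clip_ge0.
    by rewrite -lerBlDl ltW// HN.
  rewrite clip1; last by move/negP: nKx; rewrite -ltNge => /ltW; lra.
  rewrite mulr1; apply: ler_wpDl.
    by apply: addr_ge0; [exact: ltW|apply: sumr_ge0].
  by rewrite (le_trans (ler_norm _))// (le_trans (gB x))// ler_norm.
have {}LM : L g <= d + \sum_(0 <= k < N) L (f k) + `|B| * d.
  have cB : Cb (fun x : 'rV[R]_n => `|B| * clip (`|x| - M)).
    by apply: CbM => //; exact: Cb_cst.
  have cd : Cb (fun x => d + \sum_(0 <= k < N) f k x).
    by apply: CbD => //; exact: Cb_cst.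
  apply: le_trans (Lle cg (CbD cd cB) gle) _.
  rewrite LD// LD//; last exact: Cb_cst.
  by rewrite Lsum// (LZ _ cu) Lcst lerD2l ler_wpM2l.
rewrite (@le_trans _ _ (\sum_(0 <= k < N) (L (f k))%:E + e%:E)%E)//; last first.
  by rewrite leeD2r// nneseries_lim_ge// => k _ _; rewrite lee_fin L_ge0.
rewrite sumEFin -EFinD lee_fin (le_trans LM)// addrAC addrC lerD2l.
by rewrite -[X in X + _]mul1r -mulrDl /d mulrC divfK// gt_eqF.
Qed.

Theorem riesz_tight : exists Q : probability (Rd R n) R,
  forall f, Cb f -> \int[Q]_x f x = L f.
Proof. exact: (daniell_riesz LD LZ L1 L_ge0 L_series). Qed.

End riesz_tight.

(** Compactness of the segment gives a cluster point; an ultrafilter contains the preimage of each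
    neighbourhood or its complement, so the cluster point is a limit. *)
Lemma ultra_bounded_cvg (R : realType) (I : Type) (F : set_system I)
    (u : I -> R) (M : R) :
  UltraFilter F -> (forall i, `|u i| <= M) -> cvg (u @ F).
Proof.
move=> UF uM; have FF : ProperFilter F := ultra_proper.
have := @segment_compact R (- M) M; move=> /(_ (u @ F) _).
case=> [|p [_ Fp]].
  by apply: (@filterE _ F) => i /=; rewrite in_itv/= -ler_norml; exact: uM.
apply/cvg_ex; exists p => A nA.
have [//|FA] := in_ultra_setVsetC (u @^-1` A) UF.
by have [x [/= nAx Ax]] := Fp (~` A) A FA nA.
Qed.

(* The limit of the measures P i along the ultrafilter F is a positive linear
   functional on bounded continuous functions. *)
Section prokhorov.
Context (R : realType) (n : nat) (F : set_system nat) (UF : UltraFilter F).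
Variable P : nat -> probability (Rd R n) R.
Hypothesis P_tight : forall e, 0 < e -> exists M : R,
  \forall i \near F, \int[P i]_x clip (`|(x : 'rV[R]_n)| - M) <= e.

Let FF : ProperFilter F := ultra_proper.

Let L (f : 'rV[R]_n -> R) : R := lim ((fun i => \int[P i]_x f x) @ F).

Let cvgL f : Cb f -> \int[P i]_x f x @[i --> F] --> L f.
Proof.
move=> cf; have [_ [M fM]] := cf; apply: (@ultra_bounded_cvg _ _ _ _ M) => // i.
have fi := Cb_integrable (P i) cf.
rewrite (le_trans (le_normr_Rintegral _ fi))//.
have cM := Cb_cst n M.
rewrite (@le_trans _ _ (\int[P i]_x M))//.
  apply: le_Rintegral => //; last exact: (Cb_integrable (P i) cM).
  exact: integrable_norm.
by rewrite Rintegral_cst//= probability_setT mulr1.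
Qed.

(** Tightness is stated with the functions [clip (|x| - M)], which are themselves bounded and
    continuous, so that it passes to the limit functional like linearity and positivity. *)
Theorem prokhorov : exists Q : probability (Rd R n) R,
  forall f, Cb f -> \int[P i]_x f x @[i --> F] --> \int[Q]_x f x.
Proof.
have [] := @riesz_tight R n L.
- move=> f g cf cg; apply: cvg_lim => //.
  rewrite (_ : (fun i => _) = (fun i => \int[P i]_x f x + \int[P i]_x g x)).
    by apply: cvgD; exact: cvgL.
  by apply/funext => i; rewrite RintegralD//; exact: Cb_integrable.
- move=> c f cf; apply: cvg_lim => //.
  rewrite (_ : (fun i => _) = (fun i => c * \int[P i]_x f x)).
    by apply: cvgM; [exact: cvg_cst|exact: cvgL].
  by apply/funext => i; rewrite RintegralZl//; exact: Cb_integrable.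
- apply: cvg_lim => //; rewrite (_ : (fun i => _) = (fun=> 1)); first exact: cvg_cst.
  by apply/funext => i; rewrite Rintegral_cst//= probability_setT mulr1.
- move=> f cf f0; apply: limr_ge; first by apply/cvg_ex; exists (L f); exact: cvgL.
  by apply: nearW => i; apply: Rintegral_ge0.
- move=> e e0; have [M PM] := P_tight e0; exists M.
  apply: limr_le => //; apply/cvg_ex; exists (L (fun x => clip (`|x| - M))).
  apply: cvgL; apply: Cb_clip => x; apply: (continuousB _ (@cst_continuous _ _ M x)).
  exact: norm_continuous.
- by move=> Q QL; exists Q => f cf; rewrite QL//; exact: cvgL.
Qed.

End prokhorov.

(** * Test functions *)

Section row_norm.
Context (R : realType) (n : nat).
Implicit Types x : 'rV[R]_n.

Lemma le_coord_norm x i : `|x ord0 i| <= `|x|.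
Proof.
rewrite [leRHS]/Num.norm/= mx_normrE.
by rewrite -[X in X <= _]/((fun p : 'I_1 * 'I_n => `|x p.1 p.2|) (ord0, i)) le_bigmax.
Qed.

Lemma row_norm_le x (M : R) : 0 <= M -> (forall i, `|x ord0 i| <= M) -> `|x| <= M.
Proof.
move=> M0 xM; rewrite [leLHS]/Num.norm/= mx_normrE; apply: bigmax_le => // -[i j] _ /=.
by rewrite ord1.
Qed.

End row_norm.

Lemma measurable_rat_box (R : realType) n (p : 'rV[rat]_n * 'rV[rat]_n) :
  measurable (rat_box p : set (Rd R n)).
Proof.
rewrite (_ : rat_box p = \bigcap_(i in [set: 'I_n])
    ((fun x : Rd R n => (x : 'rV[R]_n) ord0 i) @^-1`
      `]ratr (p.1 ord0 i), ratr (p.2 ord0 i)[%classic)).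
  apply: fin_bigcap_measurable => // i _; rewrite -[X in measurable X]setTI.
  by apply: (continuous_measurable_Rd (@coord_continuous _ 1 n ord0 i)).
apply/seteqP; split => x /= xp i; first by move=> _; exact: xp.
exact: xp i Logic.I.
Qed.

Section test_functions.
Context (R : realType) (n : nat).

(** A continuous approximation from below of the indicator of the box [t.1]; it increases to that
    indicator as the slope [t.2] grows. *)
Definition box_test (t : 'rV[rat]_n * 'rV[rat]_n * nat) (x : 'rV[R]_n) : R :=
  \prod_(i < n) (clip (t.2%:R * (x ord0 i - ratr (t.1.1 ord0 i))) *
                 clip (t.2%:R * (ratr (t.1.2 ord0 i) - x ord0 i))).

(** All box tests in one sequence, so that imposing finitely many constraints means imposing the
    first [n]. Numbers that encode nothing get the harmless function 0. *)
Definition test (k : nat) : 'rV[R]_n -> R :=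
  if unpickle k is Some t then box_test t else fun=> 0.

Lemma box_test_Cb t : Cb (box_test t).
Proof.
suff cbp (r : seq 'I_n) : Cb (fun x : 'rV[R]_n => \prod_(i <- r)
    (clip (t.2%:R * (x ord0 i - ratr (t.1.1 ord0 i))) *
     clip (t.2%:R * (ratr (t.1.2 ord0 i) - x ord0 i)))) by exact: cbp.
elim: r => [|i r IH]; first by under eq_fun do rewrite big_nil; exact: Cb_cst.
under eq_fun do rewrite big_cons; apply: CbM => //; apply: CbM; apply: Cb_clip => x.
- apply: (continuousM (@cst_continuous _ _ _ x)).
  apply: (continuousB _ (@cst_continuous _ _ _ x)); exact: coord_continuous.
- apply: (continuousM (@cst_continuous _ _ _ x)).
  apply: (continuousB (@cst_continuous _ _ _ x)); exact: coord_continuous.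
Qed.

Lemma box_test_ge0 t x : 0 <= box_test t x.
Proof. by apply: prodr_ge0 => i _; rewrite mulr_ge0// clip_ge0. Qed.

Lemma box_test_le1 t x : box_test t x <= 1.
Proof.
apply: prodr_ile1 => i _.
by rewrite mulr_ge0 ?clip_ge0//= mulr_ile1 ?clip_ge0 ?clip_le1.
Qed.

Lemma box_test_out p j x : ~ rat_box p x -> box_test (p, j) x = 0.
Proof.
move=> /existsNP[i /negP]; rewrite negb_and -!leNgt => xp.
rewrite /box_test (bigD1 i)//= [X in X * _](_ : _ = 0) ?mul0r//.
case/orP: xp => h; [rewrite clip0 ?mul0r//|rewrite mulrC clip0 ?mul0r//];
  by rewrite mulr_ge0_le0// subr_le0.
Qed.

Lemma box_test_in p x : rat_box p x -> \forall j \near \oo, box_test (p, j) x = 1.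
Proof.
move=> px.
(* Distance to the nearer face in direction [i]; a slope of at least its inverse saturates both
   clips. *)
pose d (i : 'I_n) := Num.min (x ord0 i - ratr (p.1 ord0 i)) (ratr (p.2 ord0 i) - x ord0 i).
have d0 i : 0 < d i.
  by rewrite lt_min !subr_gt0; have /andP[-> ->] := px i.
exists (\max_i (Num.truncn (d i)^-1).+1)%N => // j /= dj.
rewrite /box_test big1// => i _.
have jd : 1 <= j%:R * d i.
  rewrite -ler_pdivrMr// div1r ltW//; apply: lt_le_trans (truncnS_gt _) _.
  by rewrite ler_nat; apply: leq_trans dj; apply: leq_bigmax.
rewrite !clip1 ?mulr1//.
  by rewrite (le_trans jd)// ler_wpM2l// ge_min lexx orbT.
by rewrite (le_trans jd)// ler_wpM2l// ge_min lexx.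
Qed.

Lemma le_box_test p i j x : (i <= j)%N -> box_test (p, i) x <= box_test (p, j) x.
Proof.
move=> ij; have [px|npx] := pselect (rat_box p x); last by rewrite !box_test_out.
apply: ler_prod => k _; rewrite mulr_ge0 ?clip_ge0//=.
have /andP[a b] := px k.
by rewrite ler_pM ?clip_ge0// le_clip// ler_wpM2r ?ler_nat// subr_ge0 ltW.
Qed.

Lemma test_Cb k : Cb (test k).
Proof. by rewrite /test; case: unpickle => [t|]; [exact: box_test_Cb|exact: Cb_cst]. Qed.

Lemma test_ge0 k x : 0 <= test k x.
Proof. by rewrite /test; case: unpickle => // t; exact: box_test_ge0. Qed.

Lemma lim_integral_indic (P : probability (Rd R n) R) (A : set (Rd R n))
    (u : nat -> 'rV[R]_n -> R) : measurable A ->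
  (forall j, Cb (u j)) -> (forall j x, 0 <= u j x) ->
  (forall x i j, (i <= j)%N -> u i x <= u j x) ->
  (forall x, \forall j \near \oo, u j x = \1_A x) ->
  (\int[P]_x u j x)%:E @[j --> \oo] --> P A.
Proof.
move=> mA cu u0 ndu uA.
have <- : (\int[P]_x lim ((u j x)%:E @[j --> \oo]) = P A)%E.
  rewrite -[in RHS](setIT A) -integral_indic//.
  apply: eq_integral => x _; apply/cvg_lim => //.
  by apply: cvg_near_cst; apply: filterS (uA x) => j ->.
rewrite (_ : (fun j => _) = (fun j => \int[P]_x (u j x)%:E)%E); last first.
  by apply/funext => j; rewrite EFin_Rintegral//; exact: Cb_integrable.
apply: cvg_monotone_convergence => //.
- by move=> j; apply/measurable_EFinP; apply: continuous_measurable_Rd; have [] := cu j.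
- by move=> j x _; rewrite lee_fin.
- by move=> x _ i j ij; rewrite lee_fin ndu.
Qed.

(** The measure of a rational box is a limit of test integrals. Boxes are stable under intersection,
    generate the Borel sets and exhaust the space through the cubes [g k], so the uniqueness theorem
    for measures applies. *)
Lemma test_determine (P Q : probability (Rd R n) R) :
  (forall k, \int[P]_x test k x = \int[Q]_x test k x) ->
  forall A, measurable A -> P A = Q A.
Proof.
move=> PQ A mA.
have box_eq p : P (rat_box p) = Q (rat_box p).
  have h (P' : probability (Rd R n) R) :
      (\int[P']_x box_test (p, j) x)%:E @[j --> \oo] --> P' (rat_box p).
    apply: lim_integral_indic.
    - exact: measurable_rat_box.
    - by move=> j; exact: box_test_Cb.
    - by move=> j x; exact: box_test_ge0.
    - by move=> x i j; exact: le_box_test.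
    - move=> x; rewrite indicE; have [px|npx] := pselect (rat_box p x).
        by rewrite mem_set//; exact: box_test_in.
      rewrite memNset//; apply: nearW => j; exact: box_test_out.
  apply: cvg_unique (h P) _ => //.
  rewrite (_ : (fun _ => _) = (fun j => (\int[Q]_x box_test (p, j) x)%:E)); first exact: h.
  apply/funext => j; congr EFin; have := PQ (pickle (p, j)).
  by rewrite /test pickleK.
pose g k : set (Rd R n) := rat_box (\row__ - k%:R, \row__ k%:R).
apply: (@measure_unique _ R (Rd R n) (range (@rat_box R n)) g _ _ _ _ P Q) => //.
- apply/seteqP; split.
    apply: smallest_sub; first exact: smallest_sigma_algebra.
    move=> U oU; rewrite (open_bigcup_rat_box oU).
    apply: (@countable_bigcupT_measurable _ (g_sigma_algebraType (range (@rat_box R n)))) => // p.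
    by case: ifPn => // _; apply: sub_sigma_algebra; exists p.
  apply: smallest_sub; first exact: sigma_algebra_measurable.
  by move=> _ [p _ <-]; exact: measurable_rat_box.
- move=> _ _ [p _ <-] [q _ <-].
  exists (\row_i Num.max (p.1 ord0 i) (q.1 ord0 i), \row_i Num.min (p.2 ord0 i) (q.2 ord0 i)) => //.
  have rmax a b (t : R) : (ratr (Num.max a b) < t) = (ratr a < t) && (ratr b < t).
    have [ab|/ltW ab] := leP a b; apply/idP/andP => [h|[]//]; split => //;
      by apply: le_lt_trans h; rewrite ler_rat.
  have rmin a b (t : R) : (t < ratr (Num.min a b)) = (t < ratr a) && (t < ratr b).
    have [ab|/ltW ab] := leP a b; apply/idP/andP => [h|[]//]; split => //;
      by apply: lt_le_trans h _; rewrite ler_rat.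
  apply/seteqP; split => x /=.
    move=> xpq; split => i; have := xpq i; rewrite !mxE rmax rmin andbACA;
      by move=> /andP[].
  move=> [xp xq] i; rewrite !mxE rmax rmin andbACA; apply/andP; split; [exact: xp|exact: xq].
- apply/seteqP; split => // x _; exists (Num.truncn `|x|).+1 => // i.
  rewrite !mxE rmorphN/= !ratr_nat -ltr_norml.
  by rewrite (le_lt_trans (le_coord_norm x i))// truncnS_gt.
- by move=> _ [p _ <-]; exact: box_eq.
- by move=> k; rewrite (le_lt_trans (probability_le1 _ _)) ?ltry//; exact: measurable_rat_box.
Qed.

(** A single test controls the tails: take slope 1 on a large cube. Its integral is close to 1, and
    it vanishes outside the cube. Measures whose test integrals converge to those of [P] thus
    inherit tightness. *)
Lemma test_tight (P : probability (Rd R n) R) (e : R) : 0 < e ->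
  exists k (M : R), 1 - e < \int[P]_x test k x /\
    forall x, clip (`|x| - M) <= 1 - test k x.
Proof.
move=> e0.
pose q (k : nat) : 'rV[rat]_n * 'rV[rat]_n * nat := (\row__ - k%:R, \row__ k%:R, 1%N).
have q1 k (x : 'rV[R]_n) i : `|x ord0 i| <= k%:R - 1 ->
   clip (1 * (x ord0 i - ratr ((q k).1.1 ord0 i))) *
   clip (1 * (ratr ((q k).1.2 ord0 i) - x ord0 i)) = 1 :> R.
  by rewrite !mxE rmorphN/= !ratr_nat ler_norml => /andP[? ?]; rewrite !clip1 ?mulr1; lra.
have : (\int[P]_x box_test (q k) x)%:E @[k --> \oo] --> P setT.
  apply: lim_integral_indic => //.
  - by move=> k; exact: box_test_Cb.
  - by move=> k x; exact: box_test_ge0.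
  - move=> x i j ij; apply: ler_prod => k _; rewrite mulr_ge0 ?clip_ge0//=.
    rewrite !mxE !rmorphN/= !ratr_nat.
    by rewrite ler_pM ?clip_ge0// le_clip// !mul1r lerB// ?lerN2 ler_nat.
  - move=> x; rewrite indicT; exists (Num.truncn `|x|).+2 => // k /= xk.
    rewrite /box_test big1// => i _; apply: q1.
    rewrite (le_trans (le_coord_norm x i))// lerBrDr.
    have : (Num.truncn `|x|).+2%:R <= k%:R :> R by rewrite ler_nat.
    by apply: le_trans; rewrite -natr1 lerD2r ltW// truncnS_gt.
rewrite probability_setT => /fine_cvgP[_ /= cv].
have e1 : 1 - e < 1 by rewrite ltrBlDr ltrDl.
have [k _ /(_ k (leqnn k)) /= Pk] := @cvgr_gt _ _ _ _ _ _ cv _ e1.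
exists (pickle (q k)), k%:R; rewrite /test pickleK; split => // x.
have [xk|kx] := lerP `|x| k%:R.
  by rewrite clip0 ?subr_le0// subr_ge0 box_test_le1.
rewrite [q k]surjective_pairing box_test_out ?subr0 ?clip_le1//.
move=> xq; move: kx; rewrite ltNge => /negP; apply; apply: row_norm_le => // i.
by have := xq i; rewrite !mxE rmorphN/= !ratr_nat -ltr_norml => /ltW.
Qed.

End test_functions.

(** * Relaxed transport problems *)

Section as_probability.
Context d (T : measurableType d) (R : realType) (m : {measure set T -> \bar R}).

(** Gives the probability structure to a measure of mass 1, such as a value of a probability
    kernel. *)
Definition as_probability of m setT = 1%E : set T -> \bar R := m.

Variable m1 : m setT = 1%E.

HB.instance Definition _ := Measure.copy (as_probability m1) m.
HB.instance Definition _ :=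
  Measure_isProbability.Build _ _ _ (as_probability m1) m1.

End as_probability.

Section bounded_integral.
Context d (T : measurableType d) (R : realType) (n : nat).
Variables (P : probability T R) (X : {mfun T >-> Rd R n}).

Lemma Cb_comp_integrable (f : 'rV[R]_n -> R) : Cb f ->
  P.-integrable setT (EFin \o (fun t => f (X t))).
Proof.
move=> [cf [M fM]]; apply: measurable_bounded_integrable => //.
- by rewrite ltey_eq fin_num_measure.
- apply: measurableT_comp; last exact: measurable_funP.
  exact: continuous_measurable_Rd.
- exists M; split; first exact: num_real.
  by move=> x Mx y _; exact: le_trans (fM (X y)) (ltW Mx).
Qed.

Lemma Rintegral_distribution (f : 'rV[R]_n -> R) : Cb f ->
  \int[distribution P X]_x f x = \int[P]_t f (X t).
Proof.
move=> cf; rewrite /Rintegral integral_distribution//.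
- by apply/measurable_EFinP; apply: continuous_measurable_Rd; have [] := cf.
- exact: (Cb_comp_integrable cf).
Qed.

End bounded_integral.

Lemma eq_measure_Rintegral d (T : measurableType d) (R : realType)
    (m1 m2 : {measure set T -> \bar R}) (f : T -> R) :
  (forall A, measurable A -> m1 A = m2 A) -> \int[m1]_x f x = \int[m2]_x f x.
Proof. by move=> m12; rewrite /Rintegral (eq_measure_integral m2)// => A mA _; exact: m12. Qed.

Section sqnorm.
Context (R : realType) (n : nat).
Implicit Types x y : 'rV[R]_n.

Lemma sqnorm_ge0 x : 0 <= sqnorm x.
Proof. by apply: sumr_ge0 => i _; exact: sqr_ge0. Qed.

Lemma sqnorm_continuous : continuous (@sqnorm R n).
Proof.
suff cs (r : seq 'I_n) : continuous (fun x : 'rV[R]_n => \sum_(i <- r) x ord0 i ^+ 2).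
  exact: cs.
elim: r => [|i r IH].
  by under eq_fun do rewrite big_nil; exact: cst_continuous.
under eq_fun do rewrite big_cons expr2.
by move=> x; apply: (continuousD _ (IH x)); apply: continuousM; exact: coord_continuous.
Qed.

Lemma sqr_norm_le_sqnorm x : `|x| ^+ 2 <= sqnorm x.
Proof.
rewrite -(sqr_sqrtr (sqnorm_ge0 x)) ler_sqr ?nnegrE ?normr_ge0 ?sqrtr_ge0//.
apply: row_norm_le; first exact: sqrtr_ge0.
move=> i; rewrite -sqrtr_sqr ler_sqrt; last exact: sqnorm_ge0.
by rewrite /sqnorm (bigD1 i)//= lerDl sumr_ge0// => j _; exact: sqr_ge0.
Qed.

End sqnorm.

Section halves.
Context (R : realType) (d : nat).

(** Couplings live on the product sigma-algebra, while the weak compactness above is for rows. The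
    maps [halves] and [pair_row] carry measures from one setting to the other. *)
Definition lhalf (w : Rd R (d + d)) : Rd R d := lsubmx (w : 'rV[R]_(d + d)).
Definition rhalf (w : Rd R (d + d)) : Rd R d := rsubmx (w : 'rV[R]_(d + d)).
Definition pair_row (p : Rd R d * Rd R d) : Rd R (d + d) :=
  row_mx (p.1 : 'rV[R]_d) (p.2 : 'rV[R]_d).
Definition halves (w : Rd R (d + d)) : Rd R d * Rd R d := (lhalf w, rhalf w).

Lemma lsubmx_continuous : continuous (lsubmx : 'rV[R]_(d + d) -> 'rV[R]_d).
Proof.
move=> x A /nbhs_ballP[e e0 eA]; apply/nbhs_ballP; exists e => // y [_ xy].
by apply: eA; split => // i j; rewrite !mxE; exact: xy.
Qed.

Lemma rsubmx_continuous : continuous (rsubmx : 'rV[R]_(d + d) -> 'rV[R]_d).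
Proof.
move=> x A /nbhs_ballP[e e0 eA]; apply/nbhs_ballP; exists e => // y [_ xy].
by apply: eA; split => // i j; rewrite !mxE; exact: xy.
Qed.

Lemma measurable_lhalf : measurable_fun setT lhalf.
Proof. exact: (continuous_measurable_RdV lsubmx_continuous). Qed.

Lemma measurable_rhalf : measurable_fun setT rhalf.
Proof. exact: (continuous_measurable_RdV rsubmx_continuous). Qed.

Lemma measurable_halves : measurable_fun setT halves.
Proof. apply: measurable_fun_pair; [exact: measurable_lhalf|exact: measurable_rhalf]. Qed.

Lemma measurable_pair_row : measurable_fun setT pair_row.
Proof.
apply: measurable_fun_Rd => i.
have mc j : measurable_fun setT (fun x : Rd R d => (x : 'rV[R]_d) ord0 j).
  exact: (continuous_measurable_Rd (@coord_continuous _ 1 d ord0 j)).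
case: (split_ordP i) => j ->.
  rewrite (_ : (fun _ => _) = (fun x : Rd R d => (x : 'rV[R]_d) ord0 j) \o fst).
    by apply: measurableT_comp => //; exact: measurable_fst.
  by apply/funext => p /=; rewrite /pair_row row_mxEl.
rewrite (_ : (fun _ => _) = (fun x : Rd R d => (x : 'rV[R]_d) ord0 j) \o snd).
  by apply: measurableT_comp => //; exact: measurable_snd.
by apply/funext => p /=; rewrite /pair_row row_mxEr.
Qed.

HB.instance Definition _ := isMeasurableFun.Build _ _ _ _ lhalf measurable_lhalf.
HB.instance Definition _ := isMeasurableFun.Build _ _ _ _ rhalf measurable_rhalf.
HB.instance Definition _ := isMeasurableFun.Build _ _ _ _ halves measurable_halves.
HB.instance Definition _ := isMeasurableFun.Build _ _ _ _ pair_row measurable_pair_row.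

Lemma lhalf_pair_row p : lhalf (pair_row p) = p.1.
Proof. by rewrite /lhalf /pair_row row_mxKl. Qed.

Lemma rhalf_pair_row p : rhalf (pair_row p) = p.2.
Proof. by rewrite /rhalf /pair_row row_mxKr. Qed.

Definition cost (w : 'rV[R]_(d + d)) : R := sqnorm (lsubmx w - rsubmx w).

Lemma cost_continuous : continuous cost.
Proof.
suff cs (r : seq 'I_d) : continuous (fun w : 'rV[R]_(d + d) =>
    \sum_(i <- r) (w ord0 (lshift d i) - w ord0 (rshift d i)) ^+ 2).
  rewrite (_ : cost = fun w => \sum_i (w ord0 (lshift d i) - w ord0 (rshift d i)) ^+ 2).
    exact: cs.
  by apply/funext => w; rewrite /cost /sqnorm; apply: eq_bigr => i _; rewrite !mxE.
elim: r => [|i r IH].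
  by under eq_fun do rewrite big_nil; exact: cst_continuous.
under eq_fun do rewrite big_cons expr2.
by move=> w; apply: (continuousD _ (IH w)); apply: continuousM;
  apply: continuousB; exact: coord_continuous.
Qed.

Lemma measurable_cost : measurable_fun setT (fun w : Rd R (d + d) => (cost w)%:E).
Proof. by apply/measurable_EFinP; exact: (continuous_measurable_Rd cost_continuous). Qed.

Lemma measurable_sqdist :
  measurable_fun setT (fun p : Rd R d * Rd R d => (sqnorm ((p.1 : 'rV[R]_d) - p.2))%:E).
Proof.
rewrite (_ : (fun _ => _) = (fun w : Rd R (d + d) => (cost w)%:E) \o pair_row).
  by apply: measurableT_comp; [exact: measurable_cost|exact: measurable_pair_row].
apply/funext => p /=; rewrite /cost.
by have := lhalf_pair_row p; have := rhalf_pair_row p; rewrite /lhalf /rhalf => -> ->.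
Qed.

Lemma norm_le_halves (w : 'rV[R]_(d + d)) : `|w| <= Num.max `|lsubmx w| `|rsubmx w|.
Proof.
apply: row_norm_le => [|i]; first by rewrite le_max normr_ge0.
rewrite le_max; apply/orP; case: (split_ordP i) => j ->; [left|right].
  by have := le_coord_norm (lsubmx w) j; rewrite mxE.
by have := le_coord_norm (rsubmx w) j; rewrite mxE.
Qed.

Lemma Cb_lhalf (f : 'rV[R]_d -> R) : Cb f -> Cb (fun w : 'rV[R]_(d + d) => f (lsubmx w)).
Proof.
move=> [cf [M fM]]; split; last by exists M.
move=> x; apply: (@continuous_comp _ _ _ (lsubmx : 'rV[R]_(d + d) -> 'rV[R]_d) f).
  exact: lsubmx_continuous.
exact: cf.
Qed.

Lemma Cb_rhalf (f : 'rV[R]_d -> R) : Cb f -> Cb (fun w : 'rV[R]_(d + d) => f (rsubmx w)).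
Proof.
move=> [cf [M fM]]; split; last by exists M.
move=> x; apply: (@continuous_comp _ _ _ (rsubmx : 'rV[R]_(d + d) -> 'rV[R]_d) f).
  exact: rsubmx_continuous.
exact: cf.
Qed.

End halves.

Lemma clip_min (R : realType) (N t : R) : 0 < N -> 0 <= t ->
  N * clip (t / N) = Num.min N t.
Proof.
move=> N0 t0; have [Nt|tN] := leP N t.
  by rewrite clip1 ?mulr1// ler_pdivlMr// mul1r.
rewrite clip_id ?(mulrC N) ?divfK ?gt_eqF//.
by rewrite divr_ge0 ?(ltW N0)//= ler_pdivrMr// mul1r ltW.
Qed.

Section relaxation.
Local Open Scope ereal_scope.
Context (R : realType) (d : nat).
Implicit Types (alpha mu : probability (Rd R d) R).
Implicit Types (pi : probability (Rd R (d + d)) R) (a b : nat -> R).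

Definition test_integrals (m : {measure set (Rd R d) -> \bar R}) (k : nat) : R :=
  (\int[m]_x test k x)%R.

Definition penalty (n : nat) pi a b : R :=
  (\sum_(k < n) (`|\int[pi]_w test k (lhalf w) - a k| +
                 `|\int[pi]_w test k (rhalf w) - b k|))%R.

(* Couplings are allowed to violate finitely many marginal constraints, at a price;
   the value then depends continuously on finitely many integrals of the marginals. *)
Definition relaxed_W2sq (n : nat) a b : \bar R :=
  ereal_inf [set \int[pi]_w (cost w)%:E + (n%:R * penalty n pi a b)%:E |
             pi in [set: probability (Rd R (d + d)) R]].

Lemma penalty_ge0 n pi a b : (0 <= penalty n pi a b)%R.
Proof. by apply: sumr_ge0 => k _; rewrite addr_ge0. Qed.

Lemma integral_cost_ge0 pi : 0 <= \int[pi]_w (cost w)%:E.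
Proof. by apply: integral_ge0 => w _; rewrite lee_fin sqnorm_ge0. Qed.

Lemma relaxed_W2sq_ge0 n a b : 0 <= relaxed_W2sq n a b.
Proof.
apply: le_ereal_inf_tmp => _ [pi _ <-].
by rewrite adde_ge0 ?integral_cost_ge0// lee_fin mulr_ge0// penalty_ge0.
Qed.

Lemma le_penalty m n pi a b : (m <= n)%N -> (penalty m pi a b <= penalty n pi a b)%R.
Proof.
move=> mn; rewrite /penalty -!(big_mkord predT (fun k =>
  `|\int[pi]_w test k (lhalf w) - a k| + `|\int[pi]_w test k (rhalf w) - b k|)%R).
by rewrite (big_cat_nat _ mn)//= lerDl sumr_ge0.
Qed.

Lemma le_relaxed_W2sq m n a b : (m <= n)%N ->
  relaxed_W2sq m a b <= relaxed_W2sq n a b.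
Proof.
move=> mn; apply: le_ereal_inf_tmp => _ [pi _ <-].
apply: (@le_trans _ _ (\int[pi]_w (cost w)%:E + (m%:R * penalty m pi a b)%:E)).
  by apply: ereal_inf_lbound; exists pi.
rewrite leeD2l// lee_fin; by apply: ler_pM; rewrite ?penalty_ge0 ?ler_nat ?le_penalty.
Qed.

(** The penalty is Lipschitz in [b] with a constant independent of the plan, so the infimum inherits
    it. The error does not involve [a], hence will be uniform in [z]. *)
Lemma relaxed_W2sq_perturb n a b b' :
  relaxed_W2sq n a b <=
  relaxed_W2sq n a b' + (n%:R * \sum_(k < n) `|b' k - b k|)%:E.
Proof.
rewrite -leeBlDr//; apply: le_ereal_inf_tmp => _ [pi _ <-]; rewrite leeBlDr//.
apply: (@le_trans _ _ (\int[pi]_w (cost w)%:E + (n%:R * penalty n pi a b)%:E)).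
  by apply: ereal_inf_lbound; exists pi.
rewrite -[leRHS]addeA leeD2l// -EFinD lee_fin -mulrDr ler_wpM2l//.
rewrite /penalty -big_split ler_sum//= => k _.
rewrite -addrA lerD2l (le_trans _ (ler_normD _ _))//.
by rewrite le_eqVlt; apply/orP; left; apply/eqP; congr (`|_|)%R; ring.
Qed.

Lemma W2sq_ge0 (m1 m2 : {measure set (Rd R d) -> \bar R}) : 0 <= W2sq m1 m2.
Proof.
apply: le_ereal_inf_tmp => _ [p _ <-].
by apply: integral_ge0 => xy _; rewrite lee_fin sqnorm_ge0.
Qed.

(** A true coupling, viewed as a measure on rows, competes in the relaxed problem with zero
    penalty. *)
Lemma relaxed_le_W2sq n alpha mu :
  relaxed_W2sq n (test_integrals alpha) (test_integrals mu) <= W2sq alpha mu.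
Proof.
apply: le_ereal_inf_tmp => _ [p [p1 p2] <-].
apply: ereal_inf_lbound; exists (distribution p (@pair_row R d)) => //.
have -> : penalty n (distribution p (@pair_row R d)) (test_integrals alpha)
    (test_integrals mu) = 0%R.
  rewrite /penalty big1// => k _.
  have -> : (\int[distribution p (@pair_row R d)]_w test k (lhalf w) =
      test_integrals alpha k)%R.
    rewrite (Rintegral_distribution _ _ (Cb_lhalf (test_Cb R d k))).
    rewrite /test_integrals -(eq_measure_Rintegral _ p1).
    rewrite (Rintegral_distribution _ _ (test_Cb R d k)).
    by apply: eq_Rintegral => xy _; congr test; exact: lhalf_pair_row.
  have -> : (\int[distribution p (@pair_row R d)]_w test k (rhalf w) =
      test_integrals mu k)%R.
    rewrite (Rintegral_distribution _ _ (Cb_rhalf (test_Cb R d k))).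
    rewrite /test_integrals -(eq_measure_Rintegral _ p2).
    rewrite (Rintegral_distribution _ _ (test_Cb R d k)).
    by apply: eq_Rintegral => xy _; congr test; exact: rhalf_pair_row.
  by rewrite !subrr normr0 addr0.
rewrite mulr0 adde0 ge0_integral_distribution; last 2 first.
- exact: measurable_cost.
- by move=> w; rewrite lee_fin sqnorm_ge0.
apply: eq_integral => xy _ /=; rewrite /cost.
by have := lhalf_pair_row xy; have := rhalf_pair_row xy; rewrite /lhalf /rhalf => -> ->.
Qed.

End relaxation.

Section relaxation_limit.
Local Open Scope ereal_scope.
Context (R : realType) (d : nat).

(** The cost is unbounded, so weak convergence is applied to its truncations. The level is [N.+1]
    because [clip_min] divides by it. *)
Lemma cost_truncation_cvg (Q : probability (Rd R (d + d)) R) :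
  \int[Q]_w (Num.min N.+1%:R (cost w))%:E @[N --> \oo] -->
  \int[Q]_w (cost w)%:E.
Proof.
have -> : \int[Q]_w (cost w)%:E =
    \int[Q]_w lim ((Num.min N.+1%:R (cost w))%:E @[N --> \oo]).
  apply: eq_integral => w _; apply/esym/cvg_lim => //; apply: cvg_near_cst.
  exists (Num.truncn (cost w)) => // N /= wN; congr EFin; apply: min_r.
  by rewrite ltW// (lt_le_trans (truncnS_gt _))// ler_nat.
apply: cvg_monotone_convergence => //.
- move=> N; apply/measurable_EFinP; apply: measurable_minr => //.
  by apply/measurable_EFinP; exact: measurable_cost.
- by move=> N w _; rewrite lee_fin le_min ler0n sqnorm_ge0.
- move=> w _ i j ij; rewrite lee_fin le_min !ge_min ler_nat ltnS ij/=.
  by rewrite lexx orbT.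
Qed.

(** The plan at level [n] has penalty at most [l / n], so each test integral of its halves converges
    to that of [alpha] or [mu]. This makes the plans tight and forces the marginals of their limit;
    the cost does not increase in the limit. *)
Lemma W2sq_le_relaxed (alpha mu : probability (Rd R d) R) (l : R) :
  (forall n, exists pi : probability (Rd R (d + d)) R,
    \int[pi]_w (cost w)%:E +
    (n%:R * penalty n pi (test_integrals alpha) (test_integrals mu))%:E <= l%:E) ->
  W2sq alpha mu <= l%:E.
Proof.
move=> /choice[pi piP].
have costpi n : \int[pi n]_w (cost w)%:E <= l%:E.
  apply: le_trans (piP n); rewrite leeDl// lee_fin.
  by rewrite mulr_ge0// penalty_ge0.
have penl n : (n%:R * penalty n (pi n) (test_integrals alpha) (test_integrals mu) <= l)%R.
  rewrite -lee_fin; apply: le_trans (piP n).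
  by rewrite leeDr// integral_cost_ge0.
have [F [UF ooF]] := ultraFilterLemma (@eventually_filter).
have FF : ProperFilter F := ultra_proper.
have l0 : (0 <= l)%R by rewrite -lee_fin (le_trans (integral_cost_ge0 (pi 0%N))).
have small (u : nat -> R) : (forall n, 0 <= u n)%R ->
    (\forall n \near \oo, n%:R * u n <= l)%R -> u n @[n --> F] --> (0 : R)%R.
  move=> u0 ul; apply: (@cvg_trans _ (u n @[n --> \oo])).
    by move=> A; exact: ooF.
  apply/cvgr0Pnorm_lt => e e0.
  near=> n; rewrite ger0_norm//.
  have n0 : (0 < n%:R :> R)%R.
    by rewrite ltr0n; near: n; exact: nbhs_infty_gt.
  rewrite -(ltr_pM2l n0); apply: (@le_lt_trans _ _ l); first by near: n.
  rewrite -ltr_pdivrMr//; near: n; exact: nbhs_infty_gtr.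
have cvgl k : (\int[pi n]_w test k (lhalf w))%R @[n --> F] --> test_integrals alpha k.
  apply: cvg_sub0 (cvg_cst _); apply/norm_cvg0P/small => //.
  exists k.+1 => // n /= kn; apply: le_trans (penl n); rewrite ler_wpM2l//.
  by rewrite /penalty (bigD1 (Ordinal kn))//= -addrA lerDl addr_ge0// sumr_ge0.
have cvgr k : (\int[pi n]_w test k (rhalf w))%R @[n --> F] --> test_integrals mu k.
  apply: cvg_sub0 (cvg_cst _); apply/norm_cvg0P/small => //.
  exists k.+1 => // n /= kn; apply: le_trans (penl n); rewrite ler_wpM2l//.
  by rewrite /penalty (bigD1 (Ordinal kn))//= addrAC addrC lerDl addr_ge0// sumr_ge0.
(* A large row has a large half, so its tail is bounded by the defects [1 - test] of one test for
   each marginal, of integral below [e / 2] each. *)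
have tight (e : R) : (0 < e)%R -> exists M : R,
    \forall n \near F, (\int[pi n]_w clip (`|(w : 'rV[R]_(d + d))| - M) <= e)%R.
  move=> e0; have e2 : (0 < e / 2)%R by rewrite divr_gt0.
  have [k [M [kM hM]]] := test_tight alpha e2.
  have [k' [M' [kM' hM']]] := test_tight mu e2.
  exists (Num.max M M'); near=> n.
  have c1 := Cb_cst (d + d) (1%R : R).
  have ck := Cb_lhalf (test_Cb R d k); have ck' := Cb_rhalf (test_Cb R d k').
  apply: (@le_trans _ _ (\int[pi n]_w
      ((1 - test k (lhalf w)) + (1 - test k' (rhalf w))))%R).
    apply: le_Rintegral => //.
    - apply: Cb_integrable; apply: Cb_clip => w.
      apply: (continuousB _ (@cst_continuous _ _ _ w)); exact: norm_continuous.
    - exact: (Cb_integrable (pi n) (CbD (CbB c1 ck) (CbB c1 ck'))).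
    move=> w _; have := norm_le_halves w; rewrite le_max => /orP[] wh.
      apply: ler_wpDr; first by rewrite (le_trans _ (hM' _))// clip_ge0.
      by apply: le_trans (hM _); rewrite le_clip// lerB// le_max lexx.
    apply: ler_wpDl; first by rewrite (le_trans _ (hM _))// clip_ge0.
    by apply: le_trans (hM' _); rewrite le_clip// lerB// le_max lexx orbT.
  rewrite RintegralD//; last 2 first.
  - exact: (Cb_integrable (pi n) (CbB c1 ck)).
  - exact: (Cb_integrable (pi n) (CbB c1 ck')).
  rewrite !RintegralB//; try exact: (Cb_integrable (pi n) c1).
  - rewrite Rintegral_cst//= probability_setT mulr1.
    have a1 : (1 - e / 2 < \int[pi n]_w test k (lhalf w))%R.
      by near: n; exact: cvgr_gt (cvgl k) _ kM.
    have a2 : (1 - e / 2 < \int[pi n]_w test k' (rhalf w))%R.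
      by near: n; exact: cvgr_gt (cvgr k') _ kM'.
    by lra.
  - exact: (Cb_integrable (pi n) ck').
  - exact: (Cb_integrable (pi n) ck).
have [Q Qcvg] := prokhorov UF tight.
pose p := distribution Q (@halves R d).
have pc : coupling alpha mu p.
  split=> A mA.
    transitivity (distribution Q (@lhalf R d) A) => //.
    apply: test_determine => // k.
    rewrite (Rintegral_distribution _ _ (test_Cb R d k)).
    apply/esym/(cvg_unique _ (cvgl k)) => //.
    exact: (Qcvg _ (Cb_lhalf (test_Cb R d k))).
  transitivity (distribution Q (@rhalf R d) A) => //.
  apply: test_determine => // k.
  rewrite (Rintegral_distribution _ _ (test_Cb R d k)).
  apply/esym/(cvg_unique _ (cvgr k)) => //.
  exact: (Qcvg _ (Cb_rhalf (test_Cb R d k))).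
apply: (@le_trans _ _ (\int[p]_xy (sqnorm ((xy.1 : 'rV[R]_d) - xy.2)%R)%:E)).
  by apply: ereal_inf_lbound; exists p.
rewrite ge0_integral_distribution; last 2 first.
- exact: measurable_sqdist.
- by move=> xy; rewrite lee_fin sqnorm_ge0.
rewrite [leLHS](_ : _ = \int[Q]_w (cost w)%:E)//.
(* Lower semicontinuity: each truncated cost passes to the limit exactly, with integrals at most
   [l], and the truncation is removed last. *)
apply: (cvge_le _ (@cost_truncation_cvg Q)).
apply: nearW => N.
have cN : Cb (fun w : 'rV[R]_(d + d) => Num.min N.+1%:R (cost w)).
  rewrite (_ : (fun _ => _) = fun w => N.+1%:R * clip (cost w / N.+1%:R))%R.
    apply: CbM; first exact: Cb_cst.
    apply: Cb_clip => w; apply: (continuousM (@cost_continuous R d w)).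
    exact: cst_continuous.
  by apply/funext => w; rewrite clip_min// sqnorm_ge0.
rewrite -EFin_Rintegral; last exact: Cb_integrable.
rewrite lee_fin; rewrite -(cvg_lim (@Rhausdorff R) (Qcvg _ cN)).
apply: limr_le; first by apply/cvg_ex; eexists; exact: (Qcvg _ cN).
apply: nearW => n.
rewrite -lee_fin EFin_Rintegral; last exact: Cb_integrable.
apply: le_trans (costpi n); apply: ge0_le_integral => //.
- by move=> w _; rewrite lee_fin le_min ler0n sqnorm_ge0.
- by apply/measurable_EFinP; apply: continuous_measurable_Rd; have [] := cN.
- exact: measurable_cost.
- by move=> w _; rewrite lee_fin ge_min lexx orbT.
Unshelve. all: by end_near. Qed.

End relaxation_limit.

Section W2sq_limit.
Local Open Scope ereal_scope.
Context (R : realType) (d : nat).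
Implicit Types alpha mu : probability (Rd R d) R.

Lemma W2sq_cvg_relaxed alpha mu :
  relaxed_W2sq d n (test_integrals alpha) (test_integrals mu) @[n --> \oo] -->
  W2sq alpha mu.
Proof.
pose u n := relaxed_W2sq d n (test_integrals alpha) (test_integrals mu).
rewrite [X in _ --> X](_ : _ = ereal_sup (range u)).
  by apply: ereal_nondecreasing_cvgn => m n; exact: le_relaxed_W2sq.
apply/eqP; rewrite eq_le; apply/andP; split; last first.
  by apply: ge_ereal_sup => _ [n _ <-]; exact: relaxed_le_W2sq.
have le_sup n : u n <= ereal_sup (range u) by apply: ereal_sup_ubound; exists n.
have sup0 : 0 <= ereal_sup (range u).
  by apply: le_trans (le_sup 0%N); exact: relaxed_W2sq_ge0.
case supE : (ereal_sup (range u)) => [r| |]; last 2 first.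
- by rewrite leey.
- by rewrite supE in sup0.
(* The slack [e] provides an actual plan at each level, whether or not the infimum is attained. *)
apply/lee_addgt0Pr => e e0; rewrite -EFinD; apply: W2sq_le_relaxed => n.
have : u n < (r + e)%:E.
  by apply: le_lt_trans (le_sup n) _; rewrite supE lte_fin ltrDl.
by move=> /ereal_inf_lt[_ [pi _ <-] /ltW h]; exists pi.
Qed.

Lemma eq_W2sq (m1 m1' m2 m2' : {measure set (Rd R d) -> \bar R}) :
  (forall A, measurable A -> m1 A = m1' A) ->
  (forall A, measurable A -> m2 A = m2' A) -> W2sq m1 m2 = W2sq m1' m2'.
Proof.
move=> h1 h2; rewrite /W2sq (_ : coupling m1 m2 = coupling m1' m2')//.
apply/funext => p; apply: propext; split=> -[c1 c2]; split => A mA.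
- by rewrite c1// h1.
- by rewrite c2// h2.
- by rewrite c1// h1.
- by rewrite c2// h2.
Qed.

(** Views the first [n] test integrals as a point of a finite-dimensional space, where openness
    makes sense; [penalty n] never reads the default value 0. *)
Definition extend_row (n : nat) (v : 'rV[R]_n) (k : nat) : R :=
  if insub k is Some i then v ord0 i else 0%R.

Lemma penalty_extend_row n (pi : probability (Rd R (d + d)) R) (a b : nat -> R) :
  penalty n pi a b = penalty n pi (extend_row (\row_(i < n) a i)) b.
Proof.
by apply: eq_bigr => i _; congr (_ + _)%R; rewrite /extend_row valK mxE.
Qed.

Lemma penalty_continuous n (pi : probability (Rd R (d + d)) R) (b : nat -> R) :
  continuous (fun v : 'rV[R]_n => penalty n pi (extend_row v) b).
Proof.
suff cs (r : seq 'I_n) : continuous (fun v : 'rV[R]_n => \sum_(k <- r)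
    (`|\int[pi]_w test k (lhalf w) - v ord0 k| +
     `|\int[pi]_w test k (rhalf w) - b k|))%R.
  rewrite (_ : (fun _ => _) = (fun v : 'rV[R]_n => \sum_(k <- index_enum 'I_n)
    (`|\int[pi]_w test k (lhalf w) - v ord0 k| +
     `|\int[pi]_w test k (rhalf w) - b k|))%R); first exact: cs.
  by apply/funext => v; apply: eq_bigr => i _; rewrite /extend_row valK.
elim: r => [|i r IH].
  by under eq_fun do rewrite big_nil; exact: cst_continuous.
under eq_fun do rewrite big_cons.
move=> v; apply: (continuousD _ (IH v)); apply: (continuousD _ (@cst_continuous _ _ _ v)).
apply: (@continuous_comp _ _ _ (fun v : 'rV[R]_n => \int[pi]_w test i (lhalf w) - v ord0 i)%R
  (fun t : R => `|t|)%R); last exact: norm_continuous.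
by apply: (continuousB (@cst_continuous _ _ _ v)); exact: coord_continuous.
Qed.

(** The set where an infimum is below [c] is the union, over all plans, of the sets where their
    values are. This union is uncountable, but each member is the preimage of an open set of the
    first [n] values of [a], and open sets are stable under arbitrary unions. *)
Lemma measurable_relaxed_W2sq d' (Z : measurableType d') (n : nat)
    (a : Z -> nat -> R) (b : nat -> R) :
  (forall k, measurable_fun setT (a ^~ k)) ->
  measurable_fun setT (fun z => relaxed_W2sq d n (a z) b).
Proof.
move=> ma; apply: (measurability _ (ErealGenInftyO.measurableE R)).
move=> _ [_ [c ->] <-]; rewrite setTI.
pose U : set 'rV[R]_n := \bigcup_(pi in [set: probability (Rd R (d + d)) R])
  [set v | \int[pi]_w (cost w)%:E + (n%:R * penalty n pi (extend_row v) b)%:E < c%:E].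
pose row_a (z : Z) : Rd R n := (\row_(i < n) a z i)%R.
rewrite [X in measurable X](_ : _ = row_a @^-1` U).
  have mrow : measurable_fun setT row_a.
    by apply: measurable_fun_Rd => i; under eq_fun do rewrite mxE; exact: ma.
  rewrite -[X in measurable X]setTI; apply: mrow => //; apply: sub_sigma_algebra.
  apply: bigcup_open => pi _.
  (* A plan of infinite cost contributes the empty set. *)
  have := integral_cost_ge0 pi; case: (\int[pi]_w _) => [r _| |//]; last first.
    move=> _; rewrite [X in open X](_ : _ = set0); first exact: open0.
    by apply/seteqP; split.
  have cp : continuous (fun v : 'rV[R]_n => r + n%:R * penalty n pi (extend_row v) b)%R.
    move=> v; apply: (continuousD (@cst_continuous _ _ _ v)).
    apply: (continuousM (@cst_continuous _ _ _ v)); exact: penalty_continuous.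
  have := (continuousP _).1 cp _ (@open_lt R c).
  by congr open; apply/seteqP; split => v /=; rewrite -EFinD lte_fin.
apply/seteqP; split => z; rewrite /= in_itv/=.
  by move=> /ereal_inf_lt[_ [pi _ <-] h]; exists pi; rewrite //= -penalty_extend_row.
move=> [pi _ /=]; rewrite -penalty_extend_row => h.
by apply: le_lt_trans h; apply: ereal_inf_lbound; exists pi.
Qed.

Context d' (Z : measurableType d') (k : R.-pker Z ~> Rd R d).

Definition kernel_law (z : Z) : probability (Rd R d) R :=
  as_probability (@prob_kernel _ _ _ _ _ k z).

Lemma measurable_test_integrals j :
  measurable_fun setT (fun z => test_integrals (k z) j).
Proof.
apply: measurableT_comp => //; apply: measurable_fun_integral_kernel.
- by move=> U mU; exact: measurable_kernel.
- by move=> x; rewrite lee_fin test_ge0.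
- by apply/measurable_EFinP; apply: continuous_measurable_Rd; have [] := test_Cb R d j.
Qed.

Lemma W2sq_kernel_cvg mu z :
  relaxed_W2sq d n (test_integrals (k z)) (test_integrals mu) @[n --> \oo] -->
  W2sq (k z) mu.
Proof.
have kE A : measurable A -> kernel_law z A = k z A by [].
rewrite -(eq_W2sq kE (fun A _ => erefl (mu A))).
rewrite (_ : test_integrals (k z) = test_integrals (kernel_law z)).
  exact: W2sq_cvg_relaxed.
by apply/funext => j; apply: eq_measure_Rintegral.
Qed.

Lemma relaxed_le_W2sq_kernel mu z n :
  relaxed_W2sq d n (test_integrals (k z)) (test_integrals mu) <= W2sq (k z) mu.
Proof.
rewrite -(cvg_lim (@ereal_hausdorff R) (@W2sq_kernel_cvg mu z)).
have nd : nondecreasing_seq (fun n =>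
    relaxed_W2sq d n (test_integrals (k z)) (test_integrals mu)).
  by move=> i j; exact: le_relaxed_W2sq.
rewrite (cvg_lim (@ereal_hausdorff R) (ereal_nondecreasing_cvgn nd)).
by apply: ereal_sup_ubound; exists n.
Qed.

Lemma measurable_W2sq_kernel mu : measurable_fun setT (fun z => W2sq (k z) mu).
Proof.
apply: (emeasurable_fun_cvg (fun n z =>
  relaxed_W2sq d n (test_integrals (k z)) (test_integrals mu))).
  by move=> n; apply: measurable_relaxed_W2sq => j; exact: measurable_test_integrals.
by move=> z _; exact: W2sq_kernel_cvg.
Qed.

End W2sq_limit.

(** * Second moments *)

Section disintegration_integral.
Local Open Scope ereal_scope.
Context (R : realType) (d : nat) dZ (Z : measurableType dZ).
Variables (rho : probability (Rd R d * Z)%type R) (k : R.-pker Z ~> Rd R d).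
Hypothesis rho_k : disintegration rho k.

Lemma marginalX_kernel A : measurable A ->
  marginalX rho A = \int[marginalZ rho]_z k z A.
Proof.
move=> mA; rewrite -rho_k//; congr (rho _).
by apply/seteqP; split => -[x z] //= -[].
Qed.

Let law (z : Z) : giry (Rd R d) R := kernel_law k z.

Let measurable_law : measurable_fun setT law.
Proof.
by apply: measurable_giry_codensity => // B mB; exact: measurable_kernel.
Qed.

(** By [marginalX_kernel] the marginal agrees with the Giry bind of [marginalZ rho] and [law], for
    which this is the integral formula. *)
Lemma integral_disintegration (f : Rd R d -> \bar R) :
  measurable_fun setT f -> (forall x, 0 <= f x) ->
  \int[marginalX rho]_x f x = \int[marginalZ rho]_z \int[k z]_x f x.
Proof.
move=> mf f0.
have := @giry_int_bind _ _ _ _ _ (marginalZ rho) law measurable_law f mf f0.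
rewrite /giry_int => h; transitivity (\int[giry_bind (marginalZ rho) measurable_law]_x f x).
  apply: eq_measure_integral => A mA _; apply: etrans (marginalX_kernel mA) _.
  apply/esym; apply: etrans (giry_int_map _ _ _ _) _ => //.
  exact: measurable_giry_ev.
rewrite h; apply: eq_integral => z _.
by apply: eq_measure_integral => A mA _.
Qed.

End disintegration_integral.

Section moments.
Local Open Scope ereal_scope.
Context (R : realType) (d : nat).
Implicit Types (eta : probability (Rd R d) R) (p x y : 'rV[R]_d).

Definition moment_at p (eta : {measure set (Rd R d) -> \bar R}) : \bar R :=
  \int[eta]_x (sqnorm ((x : 'rV[R]_d) - p)%R)%:E.

Lemma measurable_sqnormB p :
  measurable_fun setT (fun x : Rd R d => (sqnorm ((x : 'rV[R]_d) - p)%R)%:E).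
Proof.
apply/measurable_EFinP; apply: (@continuous_measurable_Rd R d (fun x => sqnorm (x - p))).
move=> x; apply: (@continuous_comp _ _ _ (fun x : 'rV[R]_d => x - p)%R (@sqnorm R d)).
  apply: (@continuousB R _ _ (fun x => x) (cst p)); first by move=> A.
  exact: cst_continuous.
exact: sqnorm_continuous.
Qed.

Lemma moment_at_ge0 p (eta : {measure set (Rd R d) -> \bar R}) : 0 <= moment_at p eta.
Proof. by apply: integral_ge0 => x _; rewrite lee_fin sqnorm_ge0. Qed.

Lemma second_momentE (eta : {measure set (Rd R d) -> \bar R}) :
  second_moment eta = moment_at 0 eta.
Proof. by apply: eq_integral => x _; rewrite subr0. Qed.

Lemma sqnormD_le x y : (sqnorm (x + y) <= 2 * sqnorm x + 2 * sqnorm y)%R.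
Proof.
rewrite /sqnorm !mulr_sumr -big_split ler_sum//= => i _; rewrite mxE.
rewrite -subr_ge0 (_ : _ - _ = (x ord0 i - y ord0 i) ^+ 2)%R ?sqr_ge0//.
by ring.
Qed.

Lemma moment_at_lty p q eta : moment_at p eta < +oo -> moment_at q eta < +oo.
Proof.
move=> pfin; apply: (@le_lt_trans _ _ (\int[eta]_x
    (2%:E * (sqnorm ((x : 'rV[R]_d) - p)%R)%:E + (2 * sqnorm (p - q))%:E))).
  apply: ge0_le_integral => //.
  - by move=> x _; rewrite lee_fin sqnorm_ge0.
  - exact: measurable_sqnormB.
  - apply: emeasurable_funD => //; apply: measurable_funeM; exact: measurable_sqnormB.
  - move=> x _; rewrite -EFinM -EFinD lee_fin.
    by rewrite (le_trans _ (sqnormD_le _ _))// addrA subrK.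
rewrite ge0_integralD//.
- rewrite ge0_integralZl_EFin//; last 2 first.
  + by move=> x _; rewrite lee_fin sqnorm_ge0.
  + exact: measurable_sqnormB.
  rewrite integral_cst//= probability_setT mule1 lte_add_pinfty ?ltry//.
  by rewrite lte_mul_pinfty.
- by move=> x _; rewrite mule_ge0// lee_fin sqnorm_ge0.
- by apply: measurable_funeM; exact: measurable_sqnormB.
- by move=> x _; rewrite lee_fin mulr_ge0// sqnorm_ge0.
Qed.

Lemma moment_at_mean p eta : second_moment eta < +oo ->
  moment_at (mean eta) eta <= moment_at p eta.
Proof.
rewrite second_momentE => fin0.
have mcoord i : measurable_fun setT (fun x : Rd R d => (x : 'rV[R]_d) ord0 i).
  exact: (continuous_measurable_Rd (@coord_continuous _ 1 d ord0 i)).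
have isq i (q : 'rV[R]_d) : eta.-integrable setT
    (EFin \o (fun x : Rd R d => ((x : 'rV[R]_d) ord0 i - q ord0 i) ^+ 2)%R).
  have mf : measurable_fun setT (fun x : Rd R d => ((x : 'rV[R]_d) ord0 i - q ord0 i) ^+ 2)%R.
    by apply: measurable_funX; apply: measurable_funB.
  apply/integrableP; split; first exact/measurable_EFinP.
  apply: le_lt_trans (@moment_at_lty 0%R q eta fin0).
  apply: ge0_le_integral => //.
  - by apply: measurableT_comp => //; exact/measurable_EFinP.
  - exact: measurable_sqnormB.
  - move=> x _; rewrite gee0_abs ?lee_fin ?sqr_ge0// /sqnorm (bigD1 i)//= !mxE.
    by rewrite lerDl sumr_ge0// => j _; exact: sqr_ge0.
(* From the bound of [|t|] by [1 + t ^+ 2]. *)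
have ic i : eta.-integrable setT (EFin \o (fun x : Rd R d => (x : 'rV[R]_d) ord0 i)).
  have i1 : eta.-integrable setT (EFin \o (fun x : Rd R d =>
      1 + ((x : 'rV[R]_d) ord0 i - (0 : 'rV[R]_d) ord0 i) ^+ 2)%R).
    have c1 : eta.-integrable setT (EFin \o cst 1%R).
      exact: finite_measure_integrable_cst.
    exact: (integrableD measurableT c1 (isq i 0%R)).
  apply: le_integrable i1 => //; first exact/measurable_EFinP.
  move=> x _; rewrite lee_fin mxE subr0 [leRHS]ger0_norm; last first.
    by rewrite addr_ge0// sqr_ge0.
  rewrite -[X in (_ <= _ + X)%R]real_normK ?num_real//; set t := `|_|%R.
  have t0 : (0 <= t)%R by exact: normr_ge0.
  by have := sqr_ge0 (t - 1)%R; nra.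
rewrite /moment_at /sqnorm.
have sumE (q : 'rV[R]_d) : \int[eta]_x (\sum_(i < d) ((x : 'rV[R]_d) - q)%R ord0 i ^+ 2)%:E =
    (\sum_(i < d) \int[eta]_x (((x : 'rV[R]_d) ord0 i - q ord0 i) ^+ 2))%R%:E.
  rewrite -sumEFin; under [RHS]eq_bigr do rewrite EFin_Rintegral//.
  rewrite -ge0_integral_sum//.
  - by apply: eq_integral => x _; rewrite sumEFin; congr EFin; apply: eq_bigr => i _; rewrite !mxE.
  - by move=> i; case/integrableP : (isq i q).
  - by move=> i x _; rewrite lee_fin sqr_ge0.
rewrite !sumE lee_fin ler_sum// => i _.
have -> : mean eta ord0 i = (\int[eta]_x ((x : 'rV[R]_d) ord0 i))%R by rewrite mxE.
set m := (\int[eta]_x ((x : 'rV[R]_d) ord0 i))%R; set q := p ord0 i.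
pose X (x : Rd R d) : R := (x : 'rV[R]_d) ord0 i.
have im : eta.-integrable setT (EFin \o (fun x => (X x - m) ^+ 2)%R).
  by have := isq i (const_mx m); congr integrable; apply/funext => x /=; rewrite mxE.
have iX : eta.-integrable setT (EFin \o (fun x => 2 * (m - q) * X x)%R).
  exact: (integrableZl measurableT (2 * (m - q))%R (ic i)).
have i1 : eta.-integrable setT (EFin \o cst (q ^+ 2 - m ^+ 2)%R).
  exact: finite_measure_integrable_cst.
(* Expansion about [m]; as [X] has integral [m], the last two terms integrate to [(m - q) ^+ 2]. *)
have -> : (\int[eta]_x ((X x - q) ^+ 2) =
    \int[eta]_x ((X x - m) ^+ 2 + (2 * (m - q) * X x + cst (q ^+ 2 - m ^+ 2) x)))%R.
  by apply: eq_Rintegral => x _ /=; ring.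
rewrite RintegralD//; last exact: (integrableD measurableT iX i1).
have cE : (\int[eta]_x (q ^+ 2 - m ^+ 2) = q ^+ 2 - m ^+ 2)%R.
  by rewrite Rintegral_cst//= probability_setT mulr1.
rewrite lerDl RintegralD// RintegralZl//=; last exact: ic.
rewrite cE.
by rewrite -/m; have := sqr_ge0 (m - q)%R; lra.
Qed.

End moments.

(** * Bounds on the barycenter cost *)

Section coupling_bound.
Local Open Scope ereal_scope.
Context (R : realType) (d : nat).
Implicit Types alpha mu : {measure set (Rd R d) -> \bar R}.

Lemma coupling_integral_fst alpha mu p (h : Rd R d -> \bar R) :
  coupling alpha mu p -> measurable_fun setT h -> (forall x, 0 <= h x) ->
  \int[p]_xy h xy.1 = \int[alpha]_x h x.
Proof.
move=> [p1 _] mh h0; rewrite -(@eq_measure_integral _ _ _ _ alpha (distribution p fst)).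
  by rewrite ge0_integral_distribution.
by move=> A mA _; exact: p1.
Qed.

Lemma coupling_integral_snd alpha mu p (h : Rd R d -> \bar R) :
  coupling alpha mu p -> measurable_fun setT h -> (forall x, 0 <= h x) ->
  \int[p]_xy h xy.2 = \int[mu]_x h x.
Proof.
move=> [_ p2] mh h0; rewrite -(@eq_measure_integral _ _ _ _ mu (distribution p snd)).
  by rewrite ge0_integral_distribution.
by move=> A mA _; exact: p2.
Qed.

(** Integrates a pointwise inequality against every coupling, then takes the infimum. [F] is the
    cost of a competitor built from the coupling and [G] a lower bound for it; [f] and [g] hold what
    would be negative terms on the right. *)
Lemma coupling_bound alpha mu (F : Rd R d * Rd R d -> R)
    (f g h k : Rd R d -> R) (s : R) (G : \bar R) :
  (0 < s)%R -> measurable_fun setT F -> measurable_fun setT f ->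
  measurable_fun setT g -> measurable_fun setT h -> measurable_fun setT k ->
  (forall xy, 0 <= F xy)%R -> (forall x, 0 <= f x)%R -> (forall x, 0 <= g x)%R ->
  (forall x, 0 <= h x)%R -> (forall x, 0 <= k x)%R ->
  (forall x y, F (x, y) + (f x + g y) <=
    h x + k y + s * sqnorm ((x : 'rV[R]_d) - y))%R ->
  (forall p, coupling alpha mu p -> G <= \int[p]_xy (F xy)%:E) ->
  G + (\int[alpha]_x (f x)%:E + \int[mu]_x (g x)%:E) <=
  \int[alpha]_x (h x)%:E + \int[mu]_x (k x)%:E + s%:E * W2sq alpha mu.
Proof.
move=> s0 mF mf mg mh mk F0 f0 g0 h0 k0 le GF.
set C := \int[alpha]_x (h x)%:E + \int[mu]_x (k x)%:E.
set D := \int[alpha]_x (f x)%:E + \int[mu]_x (g x)%:E.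
have C0 : 0 <= C by apply: adde_ge0; apply: integral_ge0 => x _; rewrite lee_fin.
have mE (u : Rd R d -> R) : measurable_fun setT u ->
    measurable_fun setT (fun x => (u x)%:E) by move=> mu'; exact/measurable_EFinP.
have m1 (u : Rd R d -> R) : measurable_fun setT u ->
    measurable_fun setT (fun xy : Rd R d * Rd R d => (u xy.1)%:E).
  by move=> mu'; apply/measurable_EFinP; apply: measurableT_comp => //; exact: measurable_fst.
have m2 (u : Rd R d -> R) : measurable_fun setT u ->
    measurable_fun setT (fun xy : Rd R d * Rd R d => (u xy.2)%:E).
  by move=> mu'; apply/measurable_EFinP; apply: measurableT_comp => //; exact: measurable_snd.
have bound p : coupling alpha mu p -> G + D <=
    C + s%:E * \int[p]_xy (sqnorm ((xy.1 : 'rV[R]_d) - xy.2)%R)%:E.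
  move=> cp; apply: (@le_trans _ _ (\int[p]_xy (F xy)%:E + D)).
    by rewrite leeD2r// GF.
  have int1 (u : Rd R d -> R) : measurable_fun setT u -> (forall x, 0 <= u x)%R ->
      \int[alpha]_x (u x)%:E = \int[p]_xy (u xy.1)%:E.
    by move=> mu' u0; rewrite -(coupling_integral_fst cp (mE _ mu')).
  have int2 (u : Rd R d -> R) : measurable_fun setT u -> (forall x, 0 <= u x)%R ->
      \int[mu]_x (u x)%:E = \int[p]_xy (u xy.2)%:E.
    by move=> mu' u0; rewrite -(coupling_integral_snd cp (mE _ mu')).
  rewrite /C /D (int1 f)// (int2 g)// (int1 h)// (int2 k)//.
  have msq := @measurable_sqdist R d.
  rewrite -ge0_integralZl_EFin//; last 2 first.
  - by move=> xy _; rewrite lee_fin sqnorm_ge0.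
  - exact: ltW.
  have pF xy : [set: Rd R d * Rd R d] xy -> 0 <= (F xy)%:E by rewrite lee_fin.
  have pu (u : Rd R d -> R) x : (forall x, 0 <= u x)%R -> 0 <= (u x)%:E.
    by move=> u0; rewrite lee_fin.
  have psq xy : [set: Rd R d * Rd R d] xy ->
      0 <= s%:E * (sqnorm ((xy.1 : 'rV[R]_d) - xy.2)%R)%:E.
    by move=> _; rewrite mule_ge0// lee_fin ?sqnorm_ge0// ltW.
  have mFE : measurable_fun setT (fun xy => (F xy)%:E) by exact/measurable_EFinP.
  have mfg : measurable_fun setT (fun xy : Rd R d * Rd R d => (f xy.1)%:E + (g xy.2)%:E).
    by apply: emeasurable_funD; [exact: m1|exact: m2].
  have mhk : measurable_fun setT (fun xy : Rd R d * Rd R d => (h xy.1)%:E + (k xy.2)%:E).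
    by apply: emeasurable_funD; [exact: m1|exact: m2].
  have msq' : measurable_fun setT (fun xy : Rd R d * Rd R d =>
      s%:E * (sqnorm ((xy.1 : 'rV[R]_d) - xy.2)%R)%:E) by exact: measurable_funeM.
  rewrite -(ge0_integralD _ measurableT (fun xy _ => pu f xy.1 f0) (m1 f mf)
                                        (fun xy _ => pu g xy.2 g0) (m2 g mg)).
  rewrite -(ge0_integralD _ measurableT (fun xy _ => pu h xy.1 h0) (m1 h mh)
                                        (fun xy _ => pu k xy.2 k0) (m2 k mk)).
  rewrite -(ge0_integralD _ measurableT pF mFE
    (fun xy _ => adde_ge0 (pu f xy.1 f0) (pu g xy.2 g0)) mfg).
  rewrite -(ge0_integralD _ measurableT
    (fun xy _ => adde_ge0 (pu h xy.1 h0) (pu k xy.2 k0)) mhk psq msq').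
  apply: ge0_le_integral => //.
  + by move=> xy _; rewrite -!EFinD lee_fin !addr_ge0.
  + exact: emeasurable_funD.
  + exact: emeasurable_funD.
  + by move=> [x y] _ /=; rewrite -EFinM -!EFinD lee_fin.
have := W2sq_ge0 alpha mu; case WE : (W2sq alpha mu) => [w| |//] w0; last first.
  rewrite gt0_muley ?lte_fin// addey ?leey//.
  by rewrite gt_eqF// (lt_le_trans _ C0).
apply/lee_addgt0Pr => e e0.
(* Near-optimal coupling: its excess over [W2sq] is multiplied by [s]. *)
have es : (0 < e / s)%R by rewrite divr_gt0.
have := @lb_ereal_inf_adherent _ _ _ es; rewrite -/(W2sq alpha mu).
move=> /(_ [set \int[p]_xy (sqnorm ((xy.1 : 'rV[R]_d) - xy.2)%R)%:E | p in coupling alpha mu]).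
rewrite -/(W2sq alpha mu) WE => /(_ isT)[_ [p cp <-] /ltW pw].
apply: le_trans (bound p cp) _; rewrite -[leRHS]addeA leeD2l//.
apply: (@le_trans _ _ (s%:E * (w%:E + (e / s)%:E))).
  by rewrite lee_wpmul2l// lee_fin ltW.
by rewrite -EFinD -!EFinM -EFinD lee_fin mulrDr mulrC lerD2l mulrCA divff ?mulr1// gt_eqF.
Qed.

End coupling_bound.

Lemma sqnormN (R : realType) d (x : 'rV[R]_d) : sqnorm (- x) = sqnorm x.
Proof. by apply: eq_bigr => i _; rewrite mxE sqrrN. Qed.

Definition dilate (R : realType) d (p : 'rV[R]_d) (s : R) (y : Rd R d) : Rd R d :=
  s *: ((y : 'rV[R]_d) - p) + p.

Lemma measurable_dilate (R : realType) d (p : 'rV[R]_d) (s : R) :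
  measurable_fun setT (dilate p s).
Proof.
apply: measurable_fun_Rd => i; rewrite (_ : (fun _ => _) =
    (fun y : Rd R d => s * ((y : 'rV[R]_d) ord0 i - p ord0 i) + p ord0 i)); last first.
  by apply/funext => y; rewrite !mxE.
apply: measurable_funD => //; apply: measurable_funM => //; apply: measurable_funB => //.
exact: (continuous_measurable_Rd (@coord_continuous _ 1 d ord0 i)).
Qed.

HB.instance Definition _ (R : realType) d (p : 'rV[R]_d) (s : R) :=
  isMeasurableFun.Build _ _ _ _ (dilate p s) (measurable_dilate p s).

(** Without [a] and [b] the coefficients on the right are [1 - s] and [s ^+ 2 - s], of opposite
    signs in general; the same [a] and [b] terms on both sides allow both to be made nonnegative. *)
Lemma sqnorm_dilate (R : realType) d (p x y : 'rV[R]_d) (s a b : R) :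
  sqnorm (x - dilate p s y) + (a * sqnorm (x - p) + b * sqnorm (y - p)) =
  (1 + a - s) * sqnorm (x - p) + (s ^+ 2 + b - s) * sqnorm (y - p) + s * sqnorm (x - y).
Proof.
rewrite /sqnorm !mulr_sumr -!big_split; apply: eq_bigr => i _ /=.
by rewrite !mxE; ring.
Qed.

Section cost_bound.
Local Open Scope ereal_scope.
Context (R : realType) (d : nat) dZ (Z : measurableType dZ).
Variables (rho : probability (Rd R d * Z)%type R) (k : R.-pker Z ~> Rd R d).
Hypothesis rho_k : disintegration rho k.
Implicit Types mu : probability (Rd R d) R.

Lemma cost_bound mu (F : Rd R d * Rd R d -> R) (f g h u : Rd R d -> R) (s : R)
    (G : Z -> \bar R) :
  (0 < s)%R -> measurable_fun setT F -> measurable_fun setT f ->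
  measurable_fun setT g -> measurable_fun setT h -> measurable_fun setT u ->
  measurable_fun setT G ->
  (forall xy, 0 <= F xy)%R -> (forall x, 0 <= f x)%R -> (forall x, 0 <= g x)%R ->
  (forall x, 0 <= h x)%R -> (forall x, 0 <= u x)%R -> (forall z, 0 <= G z) ->
  (forall x y, F (x, y) + (f x + g y) <=
    h x + u y + s * sqnorm ((x : 'rV[R]_d) - y))%R ->
  (forall z p, coupling (k z) mu p -> G z <= \int[p]_xy (F xy)%:E) ->
  \int[marginalZ rho]_z G z +
    (\int[marginalX rho]_x (f x)%:E + \int[mu]_x (g x)%:E) <=
  \int[marginalX rho]_x (h x)%:E + \int[mu]_x (u x)%:E +
    s%:E * barycenter_cost rho k mu.
Proof.
move=> s0 mF mf mg mh mu' mG F0 f0 g0 h0 u0 G0 le GF.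
have mk (v : Rd R d -> R) : measurable_fun setT v -> (forall x, 0 <= v x)%R ->
    measurable_fun setT (fun z => \int[k z]_x (v x)%:E).
  move=> mv v0; apply: measurable_fun_integral_kernel => //.
  - by move=> U mU; exact: measurable_kernel.
  - exact/measurable_EFinP.
have ik (v : Rd R d -> R) : measurable_fun setT v -> (forall x, 0 <= v x)%R ->
    \int[marginalX rho]_x (v x)%:E = \int[marginalZ rho]_z \int[k z]_x (v x)%:E.
  by move=> mv v0; apply: integral_disintegration => //; exact/measurable_EFinP.
have ge0 (m : {measure set (Rd R d) -> \bar R}) (v : Rd R d -> R) :
    (forall x, 0 <= v x)%R -> 0 <= \int[m]_x (v x)%:E.
  by move=> v0; apply: integral_ge0 => x _; rewrite lee_fin.
(* Integrals against [mu] do not depend on [z], and [marginalZ rho] has mass 1. *)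
have cst_int c : c = \int[marginalZ rho]_z cst c z.
  by rewrite integral_cst//= probability_setT mule1.
have mW := measurable_W2sq_kernel k mu.
rewrite (ik f)// (ik h)// [\int[mu]_x (g x)%:E]cst_int [\int[mu]_x (u x)%:E]cst_int.
rewrite /barycenter_cost -ge0_integralZl//; last 2 first.
- by move=> z _; exact: W2sq_ge0.
- by rewrite lee_fin ltW.
have pfg z : 0 <= \int[k z]_x (f x)%:E + cst (\int[mu]_x (g x)%:E) z.
  by apply: adde_ge0; exact: ge0.
have phu z : 0 <= \int[k z]_x (h x)%:E + cst (\int[mu]_x (u x)%:E) z.
  by apply: adde_ge0; exact: ge0.
have psW z : 0 <= s%:E * W2sq (k z) mu.
  by apply: mule_ge0; [rewrite lee_fin ltW|exact: W2sq_ge0].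
have mfg : measurable_fun setT (fun z =>
    \int[k z]_x (f x)%:E + cst (\int[mu]_x (g x)%:E) z).
  by apply: emeasurable_funD => //; exact: mk.
have mhu : measurable_fun setT (fun z =>
    \int[k z]_x (h x)%:E + cst (\int[mu]_x (u x)%:E) z).
  by apply: emeasurable_funD => //; exact: mk.
have msW : measurable_fun setT (fun z => s%:E * W2sq (k z) mu).
  exact: measurable_funeM.
rewrite -(ge0_integralD _ measurableT (fun z _ => ge0 (k z) f f0) (mk f mf f0)
  (fun z _ => ge0 mu g g0) (measurable_cst _)).
rewrite -(ge0_integralD _ measurableT (fun z _ => ge0 (k z) h h0) (mk h mh h0)
  (fun z _ => ge0 mu u u0) (measurable_cst _)).
rewrite -(ge0_integralD _ measurableT (fun z _ => G0 z) mG (fun z _ => pfg z) mfg).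
rewrite -(ge0_integralD _ measurableT (fun z _ => phu z) mhu (fun z _ => psW z) msW).
apply: ge0_le_integral => //.
- by move=> z _; rewrite adde_ge0.
- exact: emeasurable_funD.
- exact: emeasurable_funD.
- by move=> z _; apply: (coupling_bound s0 mF mf mg mh mu') => // p; exact: GF.
Qed.

Lemma barycenter_cost_ge0 mu : 0 <= barycenter_cost rho k mu.
Proof. by apply: integral_ge0 => z _; exact: W2sq_ge0. Qed.

Let msq (p : 'rV[R]_d) (c : R) :
  measurable_fun setT (fun x : Rd R d => c * sqnorm ((x : 'rV[R]_d) - p))%R.
Proof.
by apply: measurable_funM => //; apply/measurable_EFinP; exact: measurable_sqnormB.
Qed.

Let isq (m : {measure set (Rd R d) -> \bar R}) (p : 'rV[R]_d) (c : R) : (0 <= c)%R ->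
  \int[m]_x (c * sqnorm ((x : 'rV[R]_d) - p))%:E = c%:E * moment_at p m.
Proof.
move=> c0; under eq_integral do rewrite EFinM.
rewrite ge0_integralZl_EFin//.
- by move=> x _; rewrite lee_fin sqnorm_ge0.
- exact: measurable_sqnormB.
Qed.

Let integral0 (m : {measure set (Rd R d) -> \bar R}) : \int[m]_x (0%R : R)%:E = 0.
Proof. by rewrite integral0_eq. Qed.

Lemma moment_mu_le mu : moment_at 0 mu <=
  2%:E * moment_at 0 (marginalX rho) + 2%:E * barycenter_cost rho k mu.
Proof.
have := @cost_bound mu (fun=> 0%R) (fun=> 0%R)
  (fun x => 1 * sqnorm ((x : 'rV[R]_d) - 0))%R
  (fun x => 2 * sqnorm ((x : 'rV[R]_d) - 0))%R (fun=> 0%R) 2 (fun=> 0).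
rewrite !isq// !integral0 integral0_eq// mul1e !add0e adde0; apply => //.
- by move=> x; rewrite mulr_ge0// sqnorm_ge0.
- by move=> x; rewrite mulr_ge0// sqnorm_ge0.
- move=> x y; rewrite !subr0 mul1r !add0r addr0.
  have := sqnormD_le x (y - x)%R; rewrite addrC subrK.
  by rewrite -[(y - x)%R]opprB sqnormN.
- by move=> z p _; rewrite integral_ge0.
Qed.

Lemma moment_rho_le mu : moment_at 0 (marginalX rho) <=
  2%:E * moment_at 0 mu + 2%:E * barycenter_cost rho k mu.
Proof.
have := @cost_bound mu (fun=> 0%R) (fun x => 1 * sqnorm ((x : 'rV[R]_d) - 0))%R
  (fun=> 0%R) (fun=> 0%R) (fun x => 2 * sqnorm ((x : 'rV[R]_d) - 0))%R 2 (fun=> 0).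
rewrite !isq// !integral0 integral0_eq// mul1e !add0e adde0; apply => //.
- by move=> x; rewrite mulr_ge0// sqnorm_ge0.
- by move=> x; rewrite mulr_ge0// sqnorm_ge0.
- move=> x y; rewrite !subr0 mul1r !add0r addr0.
  by have := sqnormD_le y (x - y)%R; rewrite addrC subrK.
- by move=> z p _; rewrite integral_ge0.
Qed.

(** Dilating the second component of a coupling of [k z] and [mu] gives a coupling of [k z] and the
    dilated measure; its cost is computed by [sqnorm_dilate]. *)
Lemma cost_dilate mu (p : 'rV[R]_d) (s a b : R) :
  (0 < s)%R -> (0 <= a)%R -> (0 <= b)%R -> (0 <= 1 + a - s)%R ->
  (0 <= s ^+ 2 + b - s)%R ->
  barycenter_cost rho k (distribution mu (dilate p s)) +
    (a%:E * moment_at p (marginalX rho) + b%:E * moment_at p mu) <=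
  (1 + a - s)%:E * moment_at p (marginalX rho) +
    (s ^+ 2 + b - s)%:E * moment_at p mu + s%:E * barycenter_cost rho k mu.
Proof.
move=> s0 a0 b0 a'0 b'0; rewrite -!isq//.
have mpush : measurable_fun setT
    (fun xy : Rd R d * Rd R d => (xy.1, dilate p s xy.2)).
  apply: measurable_fun_pair; first exact: measurable_fst.
  apply: measurableT_comp; [exact: measurable_dilate|exact: measurable_snd].
apply: (@cost_bound _ (fun xy => sqnorm ((xy.1 : 'rV[R]_d) - dilate p s xy.2)%R)) => //.
- apply/measurable_EFinP.
  exact: (measurableT_comp (@measurable_sqdist R d) mpush).
- exact: measurable_W2sq_kernel.
- by move=> xy; rewrite sqnorm_ge0.
- by move=> x; rewrite mulr_ge0// sqnorm_ge0.
- by move=> x; rewrite mulr_ge0// sqnorm_ge0.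
- by move=> x; rewrite mulr_ge0// sqnorm_ge0.
- by move=> x; rewrite mulr_ge0// sqnorm_ge0.
- by move=> z; exact: W2sq_ge0.
- by move=> x y /=; rewrite sqnorm_dilate.
- move=> z q [q1 q2].
  pose push : {mfun _ >-> _} := HB.pack
    (fun xy : Rd R d * Rd R d => (xy.1, dilate p s xy.2) : Rd R d * Rd R d)
    (isMeasurableFun.Build _ _ _ _ _ mpush).
  apply: ereal_inf_lbound; exists (distribution q push).
    split=> A mA; first by rewrite -q1.
    apply: (q2 (dilate p s @^-1` A)).
    by rewrite -[X in measurable X]setTI; apply: measurable_dilate.
  rewrite ge0_integral_distribution//; first exact: measurable_sqdist.
  by move=> xy; rewrite lee_fin sqnorm_ge0.
Qed.

(** If [|y| > 2 * M], then either [|x| >= M], where the shift by [M - 1] makes the clip equal to 1,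
    or [|x - y| >= M], where the cost is at least [M ^+ 2]. *)
Lemma mu_tail_le mu (M : R) : (0 < M)%R ->
  \int[mu]_y (clip (`|(y : 'rV[R]_d)| - 2 * M))%:E <=
  \int[marginalX rho]_x (clip (`|(x : 'rV[R]_d)| - (M - 1)))%:E +
    (M ^- 2)%:E * barycenter_cost rho k mu.
Proof.
move=> M0; have mclip c : measurable_fun setT (fun x : Rd R d => clip (`|(x : 'rV[R]_d)| - c)).
  apply: (@continuous_measurable_Rd R d (fun x => clip (`|x| - c))).
  have [] // : Cb (fun x : 'rV[R]_d => clip (`|x| - c)).
  apply: Cb_clip => x; apply: (continuousB _ (@cst_continuous _ _ c x)).
  exact: norm_continuous.
have := @cost_bound mu (fun=> 0%R) (fun=> 0%R)
  (fun y : Rd R d => clip (`|(y : 'rV[R]_d)| - 2 * M))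
  (fun x : Rd R d => clip (`|(x : 'rV[R]_d)| - (M - 1))) (fun=> 0%R) (M ^- 2)%R (fun=> 0).
rewrite !integral0 integral0_eq// !add0e adde0; apply => //.
- by rewrite invr_gt0 exprn_gt0.
- by move=> x; exact: clip_ge0.
- by move=> x; exact: clip_ge0.
- move=> x y; rewrite !add0r addr0.
  have [yM|My] := lerP `|y : 'rV[R]_d| (2 * M).
    rewrite clip0 ?subr_le0// addr_ge0 ?clip_ge0// mulr_ge0 ?sqnorm_ge0//.
    by rewrite invr_ge0 exprn_ge0// ltW.
  have [Mx|xM] := lerP M `|x : 'rV[R]_d|.
    rewrite [X in (_ <= X + _)%R]clip1; last by lra.
    rewrite ler_wpDr ?clip_le1// mulr_ge0 ?sqnorm_ge0//.
    by rewrite invr_ge0 exprn_ge0// ltW.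
  rewrite (le_trans (clip_le1 _))// ler_wpDl ?clip_ge0//.
  rewrite mulrC ler_pdivlMr ?exprn_gt0// mul1r.
  apply: le_trans (sqr_norm_le_sqnorm _); rewrite ler_sqr ?nnegrE ?normr_ge0 ?(ltW M0)//.
  have := ler_normD (x : 'rV[R]_d) (y - x)%R; rewrite addrC subrK distrC; lra.
- by move=> z p _; rewrite integral_ge0.
Qed.

End cost_bound.

(** * Barycenters *)

Section existence.
Local Open Scope ereal_scope.
Context (R : realType) (d : nat) dZ (Z : measurableType dZ).
Variables (rho : probability (Rd R d * Z)%type R) (k : R.-pker Z ~> Rd R d).
Hypothesis rho_k : disintegration rho k.
Implicit Types mu : probability (Rd R d) R.

Let Cb_tail (c : R) : Cb (fun x : 'rV[R]_d => clip (`|x| - c)).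
Proof.
apply: Cb_clip => x; apply: (continuousB _ (@cst_continuous _ _ c x)).
exact: norm_continuous.
Qed.

Lemma barycenter_cost_tight (m : nat -> probability (Rd R d) R) (c e : R) :
  (forall n, barycenter_cost rho k (m n) <= c%:E) -> (0 < e)%R ->
  exists M : R, forall n, (\int[m n]_y clip (`|(y : 'rV[R]_d)| - M) <= e)%R.
Proof.
move=> mc e0; have e2 : (0 < e / 2)%R by rewrite divr_gt0.
have c0 : (0 <= c)%R by rewrite -lee_fin (le_trans _ (mc 0%N))// barycenter_cost_ge0.
have [j [M0 [jM hM]]] := test_tight (marginalX rho) e2.
(* The first two terms give [M0 <= M - 1], for the tail of [marginalX rho], and [1 <= M]. The last
   gives [c <= e / 2 * M], hence [c <= e / 2 * M ^+ 2]. *)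
pose M := (`|M0| + 1 + 2 * c / e)%R.
have ce0 : (0 <= 2 * c / e)%R by rewrite divr_ge0 ?mulr_ge0// ltW.
have M1 : (1 <= M)%R by rewrite /M; have := normr_ge0 M0; lra.
have M0' : (0 < M)%R by lra.
exists (2 * M)%R => n; rewrite -lee_fin EFin_Rintegral; last exact: Cb_integrable.
apply: le_trans (mu_tail_le rho_k (m n) M0') _.
rewrite -EFin_Rintegral; last exact: Cb_integrable.
apply: (@le_trans _ _ ((e / 2)%:E + (M ^- 2)%:E * c%:E)).
  apply: leeD; last first.
    by rewrite lee_wpmul2l// lee_fin invr_ge0 exprn_ge0// ltW.
  rewrite lee_fin (@le_trans _ _ (\int[marginalX rho]_x (1 - test j x))%R)//.
    apply: le_Rintegral => //.
    - exact: Cb_integrable.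
    - exact: (Cb_integrable (marginalX rho) (CbB (Cb_cst d 1%R) (test_Cb R d j))).
    - move=> x _; apply: le_trans (hM x); apply: le_clip; rewrite lerB//.
      by rewrite /M; have := ler_norm M0; lra.
  rewrite RintegralB//; last 2 first.
  - exact: (Cb_integrable (marginalX rho) (Cb_cst d 1%R)).
  - exact: (Cb_integrable (marginalX rho) (test_Cb R d j)).
  by rewrite Rintegral_cst//= probability_setT mulr1; move: jM; lra.
rewrite -EFinM -EFinD lee_fin.
suff : (M ^- 2 * c <= e / 2)%R by lra.
rewrite mulrC ler_pdivrMr ?exprn_gt0//.
apply: (@le_trans _ _ (e / 2 * M)%R); last first.
  by rewrite ler_wpM2l ?(ltW e2)// expr2 ler_peMr ?(ltW M0').
rewrite /M mulrDr.
have -> : (e / 2 * (2 * c / e) = c)%R by field; rewrite gt_eqF.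
by rewrite lerDr mulr_ge0 ?(ltW e2)// addr_ge0.
Qed.

Lemma exists_barycenter : ereal_inf (range (barycenter_cost rho k)) < +oo ->
  exists mu, wasserstein_barycenter rho k mu.
Proof.
have lb mu : ereal_inf (range (barycenter_cost rho k)) <= barycenter_cost rho k mu.
  by apply: ereal_inf_lbound; exists mu.
have J0 : 0 <= ereal_inf (range (barycenter_cost rho k)).
  by apply: le_ereal_inf_tmp => _ [mu _ <-]; exact: barycenter_cost_ge0.
case JE : (ereal_inf _) => [j| |] //; last by rewrite JE in J0.
move=> _.
have [m mP] : {m : nat -> probability (Rd R d) R &
    forall n, barycenter_cost rho k (m n) < (j + n.+1%:R^-1)%:E}.
  apply: (@choice _ _ (fun n mu => barycenter_cost rho k mu < (j + n.+1%:R^-1)%:E)) => n.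
  have n0 : (0 < n.+1%:R^-1 :> R)%R by rewrite invr_gt0.
  have [|_ [mu _ <-]] := @lb_ereal_inf_adherent _ (range (barycenter_cost rho k)) _ n0.
    by rewrite JE.
  by rewrite JE -EFinD => h; exists mu.
have [F [UF ooF]] := ultraFilterLemma (@eventually_filter).
have FF : ProperFilter F := ultra_proper.
have mc n : barycenter_cost rho k (m n) <= (j + 1)%:E.
  apply: le_trans (ltW (mP n)) _; rewrite lee_fin lerD2l invf_le1//.
  by rewrite ler1n.
have tight (e : R) : (0 < e)%R -> exists M : R,
    \forall n \near F, (\int[m n]_x clip (`|(x : 'rV[R]_d)| - M) <= e)%R.
  move=> e0; have [M hM] := barycenter_cost_tight mc e0.
  by exists M; apply: nearW.
have [mu mucvg] := prokhorov UF tight.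
exists mu; rewrite /wasserstein_barycenter JE; apply/eqP; rewrite eq_le.
apply/andP; split; last by rewrite -JE.
pose r n z := relaxed_W2sq d n (test_integrals (k z)) (test_integrals mu).
have mr n : measurable_fun setT (r n).
  by apply: measurable_relaxed_W2sq => i; exact: measurable_test_integrals.
(* At a fixed level, replacing [mu] by [m n] costs an amount independent of [z] that vanishes along
   [F]; the relaxed value for [m n] is below its true cost. *)
have rle N : \int[marginalZ rho]_z r N z <= j%:E.
  apply/lee_addgt0Pr => e e0; have e2 : (0 < e / 2)%R by rewrite divr_gt0.
  have : \forall n \near F, (N%:R * \sum_(i < N)
      `|test_integrals (m n) i - test_integrals mu i| < e / 2)%R.
    have cv0 i : `|test_integrals (m n) i - test_integrals mu i|%R @[n --> F] --> (0 : R)%R.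
      rewrite (_ : (0 : R)%R = `|test_integrals mu i - test_integrals mu i|%R); last first.
        by rewrite subrr normr0.
      by apply: cvg_norm; apply: cvgB; [exact: mucvg (test_Cb R d i)|exact: cvg_cst].
    have cvS (M : nat) : (\sum_(i < M)
        `|test_integrals (m n) i - test_integrals mu i|)%R @[n --> F] --> (0 : R)%R.
      elim: M => [|M IH].
        rewrite (_ : (fun n => _) = cst 0%R); first exact: cvg_cst.
        by apply/funext => n; rewrite big_ord0.
      rewrite (_ : (fun n => _) = (fun n => \sum_(i < M)
          `|test_integrals (m n) i - test_integrals mu i| +
          `|test_integrals (m n) M - test_integrals mu M|)%R).
        have H := cvgD IH (cv0 M); rewrite addr0 in H; exact: H.
      by apply/funext => n; rewrite big_ord_recr.
    have cvM : (N%:R * \sum_(i < N)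
        `|test_integrals (m n) i - test_integrals mu i|)%R @[n --> F] --> (N%:R * 0 : R)%R.
      by apply: cvgM; [exact: cvg_cst|exact: cvS].
    by apply: (cvgr_lt _ cvM); rewrite mulr0.
  move=> near1; have near2 : \forall n \near F, (n.+1%:R^-1 < e / 2)%R.
    by apply: ooF; exact: near_infty_natSinv_lt (PosNum e2).
  have [n [/= n1 /= n2]] := filter_ex (filterI near1 near2).
  apply: (@le_trans _ _ (\int[marginalZ rho]_z (W2sq (k z) (m n) + cst (e / 2)%:E z))).
    apply: ge0_le_integral => //.
    - by move=> z _; exact: relaxed_W2sq_ge0.
    - by apply: emeasurable_funD => //; exact: measurable_W2sq_kernel.
    - move=> z _; apply: le_trans (@relaxed_W2sq_perturb R d N _ _ (test_integrals (m n))) _.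
      apply: leeD; last by rewrite lee_fin ltW.
      exact: relaxed_le_W2sq_kernel.
  rewrite ge0_integralD//; last 3 first.
  - by move=> z _; exact: W2sq_ge0.
  - exact: measurable_W2sq_kernel.
  - by move=> z _; rewrite lee_fin ltW.
  rewrite integral_cst//= probability_setT mule1.
  apply: le_trans (leeD (ltW (mP n)) (lexx _)) _.
  by rewrite -!EFinD lee_fin; move: n2; set c := (_^-1)%R; lra.
have -> : barycenter_cost rho k mu = \int[marginalZ rho]_z lim (r n z @[n --> \oo]).
  apply: eq_integral => z _; apply/esym/cvg_lim => //.
  exact: W2sq_kernel_cvg.
rewrite monotone_convergence//.
- apply: lime_le; last exact: nearW.
  apply: ereal_nondecreasing_is_cvgn => a b ab; apply: ge0_le_integral => //.
  + by move=> z _; exact: relaxed_W2sq_ge0.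
  + by move=> z _; exact: le_relaxed_W2sq.
- by move=> n z _; exact: relaxed_W2sq_ge0.
- by move=> z _ a b; exact: le_relaxed_W2sq.
Qed.

End existence.

Section variance_identity.
Local Open Scope ereal_scope.
Context (R : realType) (d : nat) dZ (Z : measurableType dZ).
Variables (rho : probability (Rd R d * Z)%type R) (k : R.-pker Z ~> Rd R d).
Hypothesis rho_k : disintegration rho k.
Implicit Types mu : probability (Rd R d) R.

(* Compare mu with its dilations about p of ratios 1 + t and 1 - t, and let t tend
   to 0: each ratio gives one inequality. *)
Lemma barycenter_moment mu p :
  wasserstein_barycenter rho k mu -> barycenter_cost rho k mu < +oo ->
  moment_at p (marginalX rho) < +oo -> moment_at p mu < +oo ->
  moment_at p (marginalX rho) = moment_at p mu + barycenter_cost rho k mu.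
Proof.
move=> bary; have lb mu' : barycenter_cost rho k mu <= barycenter_cost rho k mu'.
  by rewrite [leLHS]bary; apply: ereal_inf_lbound; exists mu'.
have dil s a b := @cost_dilate _ _ _ _ rho k rho_k mu p s a b.
have := moment_at_ge0 p (marginalX rho); have := moment_at_ge0 p mu.
have := barycenter_cost_ge0 rho k mu.
case cE : (barycenter_cost rho k mu) => [c| |] //.
case vE : (moment_at p (marginalX rho)) => [v| |] //.
case wE : (moment_at p mu) => [w| |] //.
rewrite !lee_fin => c0 w0 v0 _ _ _.
have {}dil s a b : (0 < s)%R -> (0 <= a)%R -> (0 <= b)%R -> (0 <= 1 + a - s)%R ->
    (0 <= s ^+ 2 + b - s)%R ->
    (c + (a * v + b * w) <= (1 + a - s) * v + (s ^+ 2 + b - s) * w + s * c)%R.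
  move=> s0 a0 b0 a'0 b'0; have := dil s a b s0 a0 b0 a'0 b'0.
  rewrite cE vE wE => h; rewrite -lee_fin !EFinD !EFinM.
  apply: (le_trans _ h); apply: leeD => //; rewrite -cE; exact: lb.
rewrite -EFinD; congr EFin; apply/eqP; rewrite eq_le; apply/andP; split.
(* This [t] satisfies [0 < t < 1] and [t * w <= e], the error left after division by [t]. *)
- apply/ler_addgt0Pr => e e0; pose t := (e / (w + 1 + e))%R.
  have q0 : (0 < w + 1 + e)%R by rewrite addr_gt0// ltr_wpDl.
  have t0 : (0 < t)%R by rewrite divr_gt0.
  have tw : (t * w <= e)%R.
    rewrite /t mulrAC ler_pdivrMr// ler_wpM2l ?(ltW e0)//; lra.
  (* The choice [a = t] cancels the coefficient [- t] of [v] on the right. *)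
  have := dil (1 + t)%R t 0%R _ _ _ _ _.
  have -> : (1 + t - (1 + t) = 0)%R by ring.
  rewrite addr0 (_ : ((1 + t) ^+ 2 - (1 + t) = t * (1 + t))%R); last by ring.
  rewrite !mul0r addr0 add0r => h.
  have {}h : (t * v <= t * ((1 + t) * w + c))%R.
    have := h _ _ _ _ _; rewrite ltr_wpDl ?ler01// ?(ltW t0)// lexx mulr_ge0 ?addr_ge0 ?(ltW t0)//.
    by move=> /(_ isT isT isT isT isT); lra.
  by move: h; rewrite ler_pM2l// => h; lra.
- apply/ler_addgt0Pr => e e0; pose t := (e / (w + 1 + e))%R.
  have q0 : (0 < w + 1 + e)%R by rewrite addr_gt0// ltr_wpDl.
  have t0 : (0 < t)%R by rewrite divr_gt0.
  have t1 : (t < 1)%R by rewrite ltr_pdivrMr// mul1r; lra.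
  have tw : (t * w <= e)%R.
    rewrite /t mulrAC ler_pdivrMr// ler_wpM2l ?(ltW e0)//; lra.
  have h : (c + (0 * v + t * (1 - t) * w) <= t * v + 0 * w + (1 - t) * c)%R.
    (* Now the coefficient of [w] on the right is the negative one, and [b] cancels it. *)
    have := dil (1 - t)%R 0%R (t * (1 - t))%R _ _ _ _ _.
    have -> : (1 + 0 - (1 - t) = t)%R by ring.
    have -> : ((1 - t) ^+ 2 + t * (1 - t) - (1 - t) = 0)%R by ring.
    have t0' := ltW t0; have t1' : (0 <= 1 - t)%R by rewrite subr_ge0 ltW.
    by apply => //; [rewrite subr_gt0|exact: mulr_ge0].
  have : (t * (c + (1 - t) * w) <= t * v)%R by lra.
  by rewrite ler_pM2l// => {}h; lra.
Qed.

Lemma Var_ge0 (eta : {measure set (Rd R d) -> \bar R}) : 0 <= Var eta.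
Proof. by rewrite /Var; case: ifP => // _; exact: moment_at_ge0. Qed.

(** The map [x] to [(x, 0)] couples each [k z] with the Dirac mass. Read backwards: when every cost
    is infinite, so is the second moment of [marginalX rho]. *)
Lemma cost_dirac0_le :
  barycenter_cost rho k (dirac ((0%R : 'rV[R]_d) : Rd R d)) <=
  moment_at 0 (marginalX rho).
Proof.
set o : Rd R d := (0%R : 'rV[R]_d).
have mo : measurable_fun setT (fun x : Rd R d => (x, o)).
  by apply: measurable_fun_pair => //; exact: measurable_id.
pose pair_o : {mfun _ >-> _} := HB.pack (fun x : Rd R d => (x, o) : Rd R d * Rd R d)
  (isMeasurableFun.Build _ _ _ _ _ mo).
rewrite {1}/moment_at (integral_disintegration rho_k); last 2 first.
- exact: measurable_sqnormB.
- by move=> x; rewrite lee_fin sqnorm_ge0.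
apply: ge0_le_integral => //.
- by move=> z _; exact: W2sq_ge0.
- exact: measurable_W2sq_kernel.
- apply: measurable_fun_integral_kernel.
  + by move=> U mU; exact: measurable_kernel.
  + by move=> x; rewrite lee_fin sqnorm_ge0.
  + exact: measurable_sqnormB.
move=> z _; apply: ereal_inf_lbound.
exists (distribution (kernel_law k z) pair_o).
  split=> // B mB; rewrite /distribution /pushforward /= diracE.
  have [oB|oB] := pselect (B o).
    rewrite mem_set// (_ : _ @^-1` _ = setT) ?probability_setT//.
    by apply/seteqP; split.
  rewrite memNset// (_ : _ @^-1` _ = set0) ?measure0//.
  by apply/seteqP; split.
rewrite ge0_integral_distribution//.
- exact: measurable_sqdist.
- by move=> xy; rewrite lee_fin sqnorm_ge0.
Qed.

Lemma Var_fin (eta : {measure set (Rd R d) -> \bar R}) :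
  moment_at 0 eta < +oo -> Var eta = moment_at (mean eta) eta.
Proof. by rewrite -second_momentE /Var => ->. Qed.

Lemma Var_infty (eta : {measure set (Rd R d) -> \bar R}) :
  moment_at 0 eta = +oo -> Var eta = +oo.
Proof. by rewrite -second_momentE /Var => ->; rewrite ltxx. Qed.

Lemma barycenter_Var mu : wasserstein_barycenter rho k mu ->
  Var (marginalX rho) = Var mu + barycenter_cost rho k mu.
Proof.
move=> bary; have cost0 := barycenter_cost_ge0 rho k mu.
(* By minimality an infinite cost is shared by the Dirac mass at 0, so both sides of the identity
   are infinite. *)
have [costoo|] := eqVneq (barycenter_cost rho k mu) +oo.
  rewrite costoo addey; last by rewrite gt_eqF// (lt_le_trans _ (Var_ge0 mu)).
  apply: Var_infty; apply/eqP; rewrite -leye_eq -costoo [leLHS]bary.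
  apply: le_trans cost_dirac0_le; apply: ereal_inf_lbound.
  by exists (dirac ((0%R : 'rV[R]_d) : Rd R d)).
rewrite -ltey => costfin.
have moments : (moment_at 0 (marginalX rho) < +oo) = (moment_at 0 mu < +oo).
  apply/idP/idP => fin.
    apply: le_lt_trans (moment_mu_le rho_k mu) _.
    by apply: lte_add_pinfty; apply: lte_mul_pinfty.
  apply: le_lt_trans (moment_rho_le rho_k mu) _.
  by apply: lte_add_pinfty; apply: lte_mul_pinfty.
have [mu_oo|] := eqVneq (moment_at 0 mu) +oo.
  have rho_oo : moment_at 0 (marginalX rho) = +oo.
    by apply/eqP; rewrite -leye_eq leNgt moments mu_oo ltxx.
  rewrite (Var_infty rho_oo) (Var_infty mu_oo) addye//.
  by rewrite gt_eqF// (lt_le_trans _ cost0).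
rewrite -ltey => mu_fin; have rho_fin : moment_at 0 (marginalX rho) < +oo by rewrite moments.
have momE p := barycenter_moment bary costfin (moment_at_lty p rho_fin) (moment_at_lty p mu_fin).
(* The moment identity is used at the mean of [mu] for one inequality and at the mean of
   [marginalX rho] for the other; equality of the means is not proved first. *)
rewrite !Var_fin//; apply/eqP; rewrite eq_le; apply/andP; split.
  rewrite -momE; apply: moment_at_mean; by rewrite second_momentE.
rewrite momE leeD2r//; apply: moment_at_mean; by rewrite second_momentE.
Qed.

End variance_identity.

Local Open Scope ereal_scope.

Theorem theorem3 (R : realType) (d : nat)
    (dZ : measure_display) (Z : measurableType dZ)
    (rho : probability (Rd R d * Z)%type R)
    (k : R.-pker Z ~> Rd R d)
    (rho_k : disintegration rho k) :
  exists mu : probability (Rd R d) R,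
    [/\ wasserstein_barycenter rho k mu,
        Var (marginalX rho) < +oo ->
          Var (marginalX rho) - Var mu = \int[marginalZ rho]_z W2sq (k z) mu
      & Var (marginalX rho) = Var mu + \int[marginalZ rho]_z W2sq (k z) mu].
Proof.
have [mu bary] : exists mu, wasserstein_barycenter rho k mu.
  (* With an infinite infimum every measure is a barycenter; the Dirac mass is a convenient
     witness. *)
  have [Joo|] := eqVneq (ereal_inf (range (barycenter_cost rho k))) +oo.
    exists (dirac ((0%R : 'rV[R]_d) : Rd R d)); rewrite /wasserstein_barycenter Joo.
    apply/eqP; rewrite -leye_eq -Joo; apply: ereal_inf_lbound.
    by exists (dirac ((0%R : 'rV[R]_d) : Rd R d)).
  by rewrite -ltey; exact: exists_barycenter.
exists mu; have VarE := barycenter_Var rho_k bary.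
split=> // Varfin; rewrite VarE [Var mu + _]addeC addeK//.
(* Subtraction requires [Var mu] to be finite, which the additive identity gives. *)
rewrite ge0_fin_numE ?Var_ge0//; apply: le_lt_trans Varfin.
by rewrite VarE leeDl// barycenter_cost_ge0.
Qed.
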